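(* Let $(X,T)$ be a topological dynamical system. Then the following statements are equivalent: (1) $(X,T)$ is an almost HY-system. (2) $(X,T)$ is weakly mixing, and for each non-empty open $U\subset X$ and each $\epsilon>0$ there are $k\in\mathbb{N}$ and $\mu\in\mathcal{E}(X,T^k)$ such that $\mu(U^c)<\epsilon$. (3) $(M(X),T_M)$ is a $P$-system. (4) $(M(X),T_M)$ is an almost HY-system.
   Context: A topological dynamical system (t.d.s.) is a pair $(X,T)$ with $X$ a compact metric space and $T:X\to X$ a continuous surjective map. $\mathbb{N}=\{1,2,\dots\}$ and $\mathbb{Z}_+=\mathbb{N}\cup\{0\}$. $M(X)$ is the space of Borel probability measures on $X$ with the weak$^*$-topology (a compact metrizable space), and $T_M:M(X)\to M(X)$ is $(T_M\mu)(A)=\mu(T^{-1}A)$ for Borel $A\subset X$; $(M(X),T_M)$ is again a t.d.s. For $k\in\mathbb{N}$, $\mathcal{E}(X,T^k)$ denotes the set of ergodic $T^k$-invariant Borel probability measures on $X$. $U^c=X\setminus U$. A t.d.s. $(X,T)$ is transitive if for all non-empty open $U,V\subset X$ the set $N(U,V)=\{n\in\mathbb{Z}_+: T^{-n}V\cap U\ne\emptyset\}$ is infinite; totally transitive if $(X,T^n)$ is transitive for every $n\in\mathbb{N}$; weakly mixing if $(X\times X,T\times T)$ is transitive. A point $x$ is periodic if $T^nx=x$ for some $n\in\mathbb{N}$. A $P$-system is a transitive t.d.s. whose set of periodic points is dense. A t.d.s. $(X,T)$ has almost dense periodic sets if for each non-empty open $U\subset X$ and $\epsilon>0$ there are $k\in\mathbb{N}$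 and $\mu\in M(X)$ with $T_M^k\mu=\mu$ such that $\mu(U^c)<\epsilon$. An almost HY-system is a totally transitive t.d.s. having almost dense periodic sets. (In (4) these notions are applied to the t.d.s. $(M(X),T_M)$.) *)

(* Defs.v *)
From HB Require Import structures.
From mathcomp Require Import all_boot all_order all_algebra.
From mathcomp Require Import all_classical all_reals all_analysis.
From mathcomp Require Import measurable_realfun.

Set Implicit Arguments.
Unset Strict Implicit.
Unset Printing Implicit Defensive.

Import Order.TTheory GRing.Theory Num.Theory.
Import numFieldNormedType.Exports.

Local Open Scope classical_set_scope.
Local Open Scope ring_scope.

(* The measurable types of the library are pointed, so the spaces that carry
   Borel measures are pointed, hence nonempty, as well. *)
#[short(type="pmetricType")]
HB.structure Definition PointedMetric (R : numDomainType) :=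
  {X of Pointed X & Metric R X}.

Notation borelType X := (g_sigma_algebraType (@open X)).

Lemma continuous_borel_measurable (X Y : ptopologicalType) (f : X -> Y) :
  continuous f ->
  measurable_fun [set: borelType X] (f : borelType X -> borelType Y).
Proof.
move=> /continuousP cf; apply: measurability => // _ [A oA <-].
by rewrite setTI; apply: sub_sigma_algebra; exact: cf.
Qed.

Lemma continuous_real_measurable (R : realType) (X : ptopologicalType)
    (f : X -> R) :
  continuous f -> measurable_fun [set: borelType X] (f : borelType X -> R).
Proof.
move=> /continuousP cf.
apply: (measurability _ (RGenOpens.measurableE R)) => //.
move=> _ [_ [a [b ->]] <-].
by rewrite setTI; apply: sub_sigma_algebra; apply: cf; exact: interval_open.
Qed.

Section borel_restriction.
Local Open Scope ereal_scope.
Context (R : realType) (X : ptopologicalType).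
Variable mu : probability (borelType X) R.

Definition borel_restr (A : set (borelType X)) : \bar R :=
  if `[< measurable A >] then mu A else 0.

Lemma borel_restrE A : measurable A -> borel_restr A = mu A.
Proof. by move=> mA; rewrite /borel_restr asboolT. Qed.

Let borel_restr0 : borel_restr set0 = 0.
Proof. by rewrite borel_restrE. Qed.

Let borel_restr_ge0 A : 0 <= borel_restr A.
Proof. by rewrite /borel_restr; case: ifPn. Qed.

Let borel_restr_sigma_additive : semi_sigma_additive borel_restr.
Proof.
move=> F mF tF mUF; rewrite borel_restrE//.
under eq_fun do under eq_bigr do rewrite borel_restrE//.
exact: measure_semi_sigma_additive.
Qed.

HB.instance Definition _ := isMeasure.Build _ _ _ borel_restr
  borel_restr0 borel_restr_ge0 borel_restr_sigma_additive.

Let borel_restrT : borel_restr setT = 1.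
Proof. by rewrite borel_restrE// probability_setT. Qed.

HB.instance Definition _ :=
  Measure_isProbability.Build _ _ _ borel_restr borel_restrT.

End borel_restriction.

(* M(X).  A [probability] is a function on all subsets, constrained only on the
   measurable ones; requiring the value 0 (an arbitrary choice) elsewhere makes
   Leibniz equality coincide with equality of measures, see [borel_prob_eq]. *)
Record borel_prob (R : realType) (X : ptopologicalType) := BorelProb {
  prob_of :> probability (borelType X) R;
  prob_of_nonmeasurable : forall A, ~ measurable A -> prob_of A = 0%E
}.

Lemma borel_prob_eq (R : realType) (X : ptopologicalType)
    (mu nu : borel_prob R X) :
  (forall A, measurable A -> mu A = nu A) -> mu = nu.
Proof.
case: mu nu => [mu mu0] [nu nu0] /= munu.
suff E : mu = nu by subst nu; congr BorelProb; exact: Prop_irrelevance.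
have : (mu : set (borelType X) -> \bar R) = nu.
  apply/funext => A; have [mA|nmA] := pselect (measurable A); first exact: munu.
  by rewrite mu0// nu0.
rewrite {munu mu0 nu0}.
case: mu => mu [m1 m2 m3 m4 m5 m6 m7]; case: nu => nu [n1 n2 n3 n4 n5 n6 n7] /= E.
subst nu.
case: m1 m2 m3 m4 m5 m6 m7 => a1 a2 [a3] [a4] [a5] [a6] [a7] [a8].
case: n1 n2 n3 n4 n5 n6 n7 => b1 b2 [b3] [b4] [b5] [b6] [b7] [b8].
move: b3; rewrite (Prop_irrelevance b1 a1) (Prop_irrelevance b2 a2) => b3.
by rewrite (Prop_irrelevance b3 a3) (Prop_irrelevance b4 a4)
  (Prop_irrelevance b5 a5) (Prop_irrelevance b6 a6) (Prop_irrelevance b7 a7)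
  (Prop_irrelevance b8 a8).
Qed.

HB.instance Definition _ (R : realType) (X : ptopologicalType) :=
  gen_eqMixin (borel_prob R X).
HB.instance Definition _ (R : realType) (X : ptopologicalType) :=
  gen_choiceMixin (borel_prob R X).

Lemma borel_restr_nonmeasurable (R : realType) (X : ptopologicalType)
    (mu : probability (borelType X) R) (A : set (borelType X)) :
  ~ measurable A -> borel_restr mu A = 0%E.
Proof. by move=> nmA; rewrite /borel_restr asboolF. Qed.

Definition to_borel_prob (R : realType) (X : ptopologicalType)
    (mu : probability (borelType X) R) : borel_prob R X :=
  BorelProb (@borel_restr_nonmeasurable R X mu).

HB.instance Definition _ (R : realType) (X : ptopologicalType) :=
  isPointed.Build (borel_prob R X)
    (to_borel_prob (dirac (point : borelType X))).

(* The weak* topology is the initial topology of this map, its codomain carrying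
   the topology of pointwise convergence.  Test functions are not assumed to be
   bounded, as the spaces considered are compact. *)
Definition integral_against (R : realType) (X : ptopologicalType)
    (mu : borel_prob R X) : {ptws continuousType X R -> R} :=
  fun f => \int[mu]_x f x.

HB.instance Definition _ (R : realType) (X : ptopologicalType) :=
  Topological.copy (borel_prob R X) (initial_topology (@integral_against R X)).

Lemma integral_against_continuous (R : realType) (X : ptopologicalType)
    (f : continuousType X R) :
  continuous (fun mu : borel_prob R X => integral_against mu f).
Proof.
move=> mu.
apply: (@continuous_comp _ _ _ (@integral_against R X)
  (fun h : {ptws continuousType X R -> R} => h f)).
  exact: initial_continuous.
exact: (@proj_continuous _ (fun=> R : topologicalType) f).
Qed.

Section pushforward_map.
Context (R : realType) (X : ptopologicalType) (T : continuousType X X).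

Definition borel_map : borelType X -> borelType X := T.

HB.instance Definition _ := @isMeasurableFun.Build _ _ _ _ borel_map
  (continuous_borel_measurable (@cts_fun _ _ T)).

(* T_M *)
Definition push (mu : borel_prob R X) : borel_prob R X :=
  to_borel_prob (distribution mu borel_map).

Lemma pushE (mu : borel_prob R X) (A : set (borelType X)) :
  measurable A -> push mu A = mu (T @^-1` A).
Proof. by move=> mA; rewrite /= borel_restrE. Qed.

Lemma integral_push (mu : borel_prob R X) (f : continuousType X R) :
  integral_against (push mu) f = integral_against mu (f \o T).
Proof.
rewrite /integral_against /Rintegral; congr fine.
rewrite (eq_measure_integral (distribution mu borel_map)); last first.
  by move=> A mA _ /=; rewrite borel_restrE.
pose g : borelType X -> R := f; rewrite -[f : X -> R]/g.
have mg : measurable_fun [set: borelType X] (fun x => (g x)%:E).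
  by apply/measurable_EFinP; exact: (continuous_real_measurable (@cts_fun _ _ f)).
rewrite [LHS]integralE [RHS]integralE /distribution.
rewrite !ge0_integral_pushforward//.
- by rewrite !preimage_setT -funepos_comp -funeneg_comp.
- exact: measurable_funeneg.
- exact: measurable_funepos.
Qed.

Lemma push_continuous : continuous push.
Proof.
apply: continuous_comp_initial => mu; apply/cvg_sup.
  by apply: fmap_filter; exact: nbhs_filter.
move=> f U [_ [[V oV <-] Vx]] /filterS; apply.
  by apply: fmap_filter; exact: nbhs_filter.
have := @integral_against_continuous R X (f \o T).
have -> : (fun nu => @integral_against R X nu (f \o T)) =
    (fun nu => integral_against (push nu) f).
  by apply/funext => nu; rewrite integral_push.
by move=> /(_ mu V); apply; exact: open_nbhs_nbhs.
Qed.

HB.instance Definition _ :=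
  @isContinuous.Build (borel_prob R X) (borel_prob R X) push push_continuous.

End pushforward_map.

Section dynamics.
Context (X : topologicalType) (T : X -> X).

Definition hitting_times (U V : set X) : set nat :=
  [set n | (iter n T @^-1` V) `&` U !=set0].

Definition topologically_transitive : Prop :=
  forall U V : set X, open U -> open V -> U !=set0 -> V !=set0 ->
    infinite_set (hitting_times U V).

Definition periodic_points : set X :=
  [set x | exists2 n : nat, (0 < n)%N & iter n T x = x].

Definition P_system : Prop :=
  topologically_transitive /\ dense periodic_points.

End dynamics.

Definition totally_transitive (X : topologicalType) (T : X -> X) : Prop :=
  forall n : nat, (0 < n)%N -> topologically_transitive (iter n T).

Definition weakly_mixing (X : topologicalType) (T : X -> X) : Prop :=
  topologically_transitive (fun p : X * X => (T p.1, T p.2)).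

Section measured_dynamics.
Context (R : realType) (X : ptopologicalType).

Definition ergodic_measures (S : X -> X) : set (borel_prob R X) :=
  [set mu | (forall A : set (borelType X),
               measurable A -> mu (S @^-1` A) = mu A) /\
            (forall A : set (borelType X),
               measurable A -> S @^-1` A = A -> mu A = 0%E \/ mu A = 1%E)].

Definition almost_dense_periodic_sets (T : continuousType X X) : Prop :=
  forall (U : set X) (eps : R), open U -> U !=set0 -> 0 < eps ->
    exists (k : nat) (mu : borel_prob R X),
      [/\ (0 < k)%N, iter k (push T) mu = mu & (mu (~` U) < eps%:E)%E].

Definition almost_HY_system (T : continuousType X X) : Prop :=
  totally_transitive T /\ almost_dense_periodic_sets T.

End measured_dynamics.

(* Main.v *)
(* Measures on the compact space X are handled as states (normalized positive
   functionals on continuous functions), by the Riesz representation theorem.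

   (1) => (2).  If mu is T^k-invariant with mu(U) > 1/2, then U meets T^-(nk) U
   for every n; with total transitivity this gives N(U,U) /\ N(V,W) nonempty,
   hence weak mixing.  Choose f <= 1_U continuous with large integral against a
   T^k-invariant measure; the invariant measures maximizing the integral of f
   form a closed face of the compact convex set of invariant measures, and an
   extreme point of it is ergodic (otherwise condition on an invariant set).

   (2) => (3).  Convex combinations of point masses are dense in M(X).  Given two
   of them, weak mixing moves points near the atoms of the first to points near
   the atoms of the second at one common time, and product weights match the
   coefficients.  Replacing atoms by periodic measures concentrated near them
   gives density of periodic points.

   (3) => (4).  A measure with mass > 3/4 near U and one with mass > 1/4 on both V
   and W show that N(U,V) /\ N(U,W) is nonempty, hence weak mixing, hence total
   transitivity of M(X).  Point masses at periodic points are periodic measures.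

   (4) => (1).  Take bump functions for transitivity and barycenters for periodic
   measures. *)

Require Import Defs.
From HB Require Import structures.
From mathcomp Require Import all_boot all_order all_algebra.
From mathcomp Require Import all_classical all_reals all_analysis.
From mathcomp Require Import measurable_realfun.
From mathcomp Require Import finmap lra zify.

Set Implicit Arguments.
Unset Strict Implicit.
Unset Printing Implicit Defensive.

Import Order.TTheory GRing.Theory Num.Theory.
Import numFieldNormedType.Exports.

Local Open Scope classical_set_scope.
Local Open Scope ring_scope.

(** * Continuous functions, states and integrals *)

Section continuous_real_functions.
Context (R : realType) (X : topologicalType).
Implicit Types f g : X -> R.

Definition cts f (cf : continuous f) : continuousType X R :=
  HB.pack f (isContinuous.Build X R f cf).

Lemma continuousD_fun f g : continuous f -> continuous g ->
  continuous (fun x => f x + g x).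
Proof. by move=> cf cg x; apply: cvgD; [exact: cf|exact: cg]. Qed.

Lemma continuousB_fun f g : continuous f -> continuous g ->
  continuous (fun x => f x - g x).
Proof. by move=> cf cg x; apply: cvgB; [exact: cf|exact: cg]. Qed.

Lemma continuousM_fun f g : continuous f -> continuous g ->
  continuous (fun x => f x * g x).
Proof. by move=> cf cg x; apply: cvgM; [exact: cf|exact: cg]. Qed.

Lemma continuousZ_fun a f : continuous f -> continuous (fun x => a * f x).
Proof. by apply: continuousM_fun => x; exact: cvg_cst. Qed.

Lemma continuous_cst_fun (a : R) : continuous (fun _ : X => a).
Proof. by move=> x; exact: cvg_cst. Qed.

Lemma continuous_norm_fun f : continuous f -> continuous (fun x => `|f x|).
Proof. by move=> cf x; apply: cvg_norm; exact: cf. Qed.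

Lemma continuous_min_fun f g : continuous f -> continuous g ->
  continuous (fun x => Num.min (f x) (g x)).
Proof. by move=> cf cg x; apply: continuous_min; [exact: cf|exact: cg]. Qed.

Lemma continuous_max_fun f g : continuous f -> continuous g ->
  continuous (fun x => Num.max (f x) (g x)).
Proof. by move=> cf cg x; apply: continuous_max; [exact: cf|exact: cg]. Qed.

Lemma continuous_sum_fun (I : Type) (r : seq I) (P : pred I) (F : I -> X -> R) :
  (forall i, continuous (F i)) -> continuous (fun x => \sum_(i <- r | P i) F i x).
Proof.
move=> cF; elim: r => [|i r ih].
  by under eq_fun do rewrite big_nil; exact: continuous_cst_fun.
under eq_fun do rewrite big_cons; case: (P i) => //.
exact: continuousD_fun.
Qed.

Lemma continuous_gt_open f (a : R) : continuous f -> open [set x | a < f x].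
Proof.
move=> /continuousP cf; rewrite (_ : [set x | _] = f @^-1` `]a, +oo[).
  by apply: cf; exact: interval_open.
by apply/seteqP; split => x /=; rewrite in_itv/= andbT.
Qed.

Lemma continuous_lt_open f (a : R) : continuous f -> open [set x | f x < a].
Proof.
move=> /continuousP cf; rewrite (_ : [set x | _] = f @^-1` `]-oo, a[).
  by apply: cf; exact: interval_open.
by apply/seteqP; split => x /=; rewrite in_itv/=.
Qed.

Lemma compact_continuous_bounded f : compact [set: X] -> continuous f ->
  exists2 M, 0 <= M & forall x, `|f x| <= M.
Proof.
move=> cX cf; have [M [_ fM]] :=
  compact_bounded (continuous_compact (continuous_subspaceT cf) cX).
exists (`|M| + 1) => [|x]; first by rewrite addr_ge0.
by apply: (fM (`|M| + 1) _ (f x)); [rewrite ltr_pwDr// ler_norm|exists x].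
Qed.

(** [L] is defined on all functions, but only its values on continuous ones are constrained, so
    lemmas about states carry continuity hypotheses. *)
Definition state (L : (X -> R) -> R) : Prop :=
  [/\ L (fun=> 1) = 1,
      forall f g, continuous f -> continuous g ->
        L (fun x => f x + g x) = L f + L g,
      forall a f, continuous f -> L (fun x => a * f x) = a * L f
    & forall f, continuous f -> (forall x, 0 <= f x) -> 0 <= L f].

Context (L : (X -> R) -> R) (sL : state L).

Lemma state_cst a : L (fun=> a) = a.
Proof.
have [L1 _ LZ _] := sL; rewrite -[RHS]mulr1 -[in RHS]L1 -LZ.
  by congr L; apply/funext => x; rewrite mulr1.
exact: continuous_cst_fun.
Qed.

Lemma stateB f g : continuous f -> continuous g ->
  L (fun x => f x - g x) = L f - L g.
Proof.
move=> cf cg; have [_ LD LZ _] := sL.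
rewrite -mulN1r -LZ// -LD//; last exact: continuousZ_fun.
by congr L; apply/funext => x; rewrite mulN1r.
Qed.

Lemma state_le f g : continuous f -> continuous g -> (forall x, f x <= g x) ->
  L f <= L g.
Proof.
move=> cf cg fg; have [_ _ _ L0] := sL; rewrite -subr_ge0 -stateB//.
by apply: L0 => [|x]; [exact: continuousB_fun|rewrite subr_ge0].
Qed.

Lemma state_dist_le f g e : continuous f -> continuous g ->
  (forall x, `|f x - g x| <= e) -> `|L f - L g| <= e.
Proof.
move=> cf cg fg; have cB := continuousB_fun cf cg.
rewrite ler_norml -stateB//; apply/andP; split.
  rewrite -[leLHS]state_cst; apply: state_le => // [|x].
    exact: continuous_cst_fun.
  by have := fg x; rewrite ler_norml => /andP[].
rewrite -[leRHS]state_cst; apply: state_le => // [|x].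
  exact: continuous_cst_fun.
by have := fg x; rewrite ler_norml => /andP[].
Qed.

Lemma state_sum (I : Type) (r : seq I) (F : I -> X -> R) :
  (forall i, continuous (F i)) ->
  L (fun x => \sum_(i <- r) F i x) = \sum_(i <- r) L (F i).
Proof.
move=> cF; have [_ LD _ _] := sL; elim: r => [|i r ih].
  by rewrite big_nil -[RHS]state_cst; congr L; apply/funext => x; rewrite big_nil.
rewrite big_cons -ih -LD//; last exact: continuous_sum_fun.
by congr L; apply/funext => x; rewrite big_cons.
Qed.

End continuous_real_functions.

Section integral_state.
Context (R : realType) (X : ptopologicalType).
Hypothesis compactX : compact [set: X].
Implicit Types (mu : borel_prob R X) (f g : X -> R).

Lemma continuous_integrable mu f : continuous f ->
  mu.-integrable [set: borelType X] (fun x => (f x)%:E).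
Proof.
move=> cf; apply: (@measurable_bounded_integrable _ (borelType X) R mu f) => //.
- exact: le_lt_trans (probability_le1 _ _) (ltry _).
- exact: continuous_real_measurable.
- have [M M0 fM] := compact_continuous_bounded compactX cf.
  by exists M; split; [exact: num_real|move=> N MN x _; apply: le_trans (ltW MN)].
Qed.

(** [X] is a compact topological space here, without a chosen metric, so that this also applies to
    measures on the space of measures. *)
Lemma integral_state mu : state (fun f => \int[mu]_x f x).
Proof.
split.
- by rewrite Rintegral_cst// mul1r [X in fine X](probability_setT mu).
- by move=> f g cf cg; rewrite RintegralD//; exact: continuous_integrable.
- by move=> a f cf; rewrite RintegralZl//; exact: continuous_integrable.
- by move=> f cf f0; exact: Rintegral_ge0.
Qed.

End integral_state.

(** * The Riesz representation theorem on a compact metric space *)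

(** [h] is the distance to the complement of [U], truncated at 1. An empty complement is treated
    apart, since that distance is then infinite. *)
Lemma open_support (R : realType) (X : metricType R) (U : set X) : open U ->
  exists h : X -> R, [/\ continuous h, forall x, 0 <= h x, forall x, h x <= 1
    & forall x, U x <-> 0 < h x].
Proof.
move=> oU; have [UT|/set0P[a Ua]] := eqVneq (~` U) set0.
  exists (fun=> 1); split => // [|x]; first exact: continuous_cst_fun.
  by split => // _; apply: contrapT => nUx; have : (~` U) x by []; rewrite UT.
have dfin x : edist_inf (~` U) x \is a fin_num.
  rewrite ge0_fin_numE ?edist_inf_ge0//; apply: le_lt_trans.
    by apply: ereal_inf_lbound; exists a.
  rewrite -ge0_fin_numE ?edist_ge0//; apply/edist_finP => /=.
  exists (mdist x a + 1); first by rewrite ltr_wpDl// mdist_ge0.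
  by rewrite ballEmdist/= ltrDl.
pose d x := fine (edist_inf (~` U) x).
have cd : continuous d.
  move=> x; apply: fine_cvg; rewrite fineK//; exact: edist_inf_continuous.
have d0 x : 0 <= d x by rewrite fine_ge0// edist_inf_ge0.
exists (fun x => Num.min (d x) 1); split => [|x|x|x].
- by apply: continuous_min_fun => //; exact: continuous_cst_fun.
- by rewrite le_min d0 ler01.
- by rewrite ge_min lexx orbT.
split=> [Ux|].
  have [e /= e0 xeU] : nbhs_ball x U by rewrite nbhs_ballE; exact: open_nbhs_nbhs.
  rewrite lt_min ltr01 andbT; apply: lt_le_trans e0 _.
  rewrite -lee_fin fineK//; apply: le_ereal_inf_tmp => _ /= [b Ub <-].
  by rewrite leNgt; apply/negP => /edist_lt_ball/xeU.
rewrite lt_min => /andP[dx _]; apply: contrapT => Ux.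
by move: dx; rewrite /d edist_inf0// ltxx.
Qed.

Section riesz.
Context (R : realType) (X : pmetricType R).
Hypothesis compactX : compact [set: X].
Context (L : (X -> R) -> R) (sL : state L).
Implicit Types (f : X -> R) (a b h : R).

(* A Daniell-type outer measure: the cost of [A] is the infimum of the limits of
   [L] along nondecreasing sequences of functions whose supremum is at least 1
   on [A].  Asking that the value 1 be reached at a finite index does not change
   the infimum and is stable under multiplication by the cut-offs below. *)
Definition riesz_cover (A : set X) : set (nat -> X -> R) :=
  [set g : nat -> X -> R | [/\ forall n, continuous (g n), forall n x, 0 <= g n x,
    forall x, {homo (fun n => g n x) : m n / (m <= n)%N >-> m <= n}
    & forall x, A x -> exists n, 1 <= g n x]].

Definition riesz_cost (g : nat -> X -> R) : \bar R :=
  ereal_sup [set (L (g n))%:E | n in [set: nat]].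

Definition riesz_outer (A : set X) : \bar R :=
  ereal_inf [set riesz_cost g | g in riesz_cover A].

Local Open Scope ereal_scope.

Lemma riesz_outer_le A g : riesz_cover A g -> riesz_outer A <= riesz_cost g.
Proof. by move=> Ag; apply: ereal_inf_lbound; exists g. Qed.

Lemma riesz_cost_ge g n : (L (g n))%:E <= riesz_cost g.
Proof. by apply: ereal_sup_ubound; exists n. Qed.

Lemma riesz_cost_ge0 A g : riesz_cover A g -> 0 <= riesz_cost g.
Proof.
move=> [cg g0 _ _]; apply: le_trans (riesz_cost_ge g 0); rewrite lee_fin.
by have [_ _ _] := sL; apply.
Qed.

Lemma riesz_outer_ge0 A : 0 <= riesz_outer A.
Proof.
by apply: le_ereal_inf_tmp => _ [g Ag <-]; exact: riesz_cost_ge0 Ag.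
Qed.

Lemma riesz_outer_cst (A : set X) f : continuous f ->
  (forall x, (0 <= f x)%R) -> (forall x, A x -> (1 <= f x)%R) ->
  riesz_outer A <= (L f)%:E.
Proof.
move=> cf f0 Af; apply: (@le_trans _ _ (riesz_cost (fun=> f))).
  apply: riesz_outer_le; split => // [x m n _ //|x Ax].
  by exists 0%N; exact: Af.
by apply: ge_ereal_sup => _ [n _ <-].
Qed.

Lemma riesz_outer_le1 A : riesz_outer A <= 1.
Proof.
rewrite -(state_cst sL 1); apply: riesz_outer_cst => //.
exact: continuous_cst_fun.
Qed.

Lemma riesz_outer_fin A : riesz_outer A \is a fin_num.
Proof.
rewrite ge0_fin_numE; first exact: le_lt_trans (riesz_outer_le1 A) (ltry _).
exact: riesz_outer_ge0.
Qed.

Lemma riesz_outer0 : riesz_outer set0 = 0.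
Proof.
apply/eqP; rewrite eq_le riesz_outer_ge0 andbT.
apply: (@le_trans _ _ (L (fun=> 0%R))%:E); last by rewrite (state_cst sL).
by apply: riesz_outer_cst => //; exact: continuous_cst_fun.
Qed.

Lemma le_riesz_outer : {homo riesz_outer : A B / A `<=` B >-> A <= B}.
Proof.
move=> A B AB; apply: ereal_inf_le_tmp => _ [g [cg g0 mg Bg] <-].
by exists g => //; split => // x /AB; exact: Bg.
Qed.

(** A Dini argument: for a cover [g] of the whole space the open sets [1 - e < g n] increase to it,
    so by compactness one index [N] gives [1 - e <= g N] everywhere. *)
Lemma riesz_outerT : riesz_outer setT = 1.
Proof.
apply/eqP; rewrite eq_le riesz_outer_le1/=.
apply: le_ereal_inf_tmp => _ [g [cg g0 mg Tg] <-].
apply/lee_addgt0Pr => e e0.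
have : finite_subset_cover [set: nat]
    (fun n => [set x | (1 - e < g n x)%R]) [set: X].
  move: compactX; rewrite compact_cover; apply => [n _|x _].
    exact: continuous_gt_open.
  have [n gn] := Tg x I; exists n => //=.
  by rewrite (lt_le_trans _ gn)// ltrBlDr ltrDl.
move=> [D _ DX].
have [N DN] : exists N : nat, forall n : nat, n \in D -> (n <= N)%N.
  exists (\max_(n <- finmap.enum_fset D) n)%N => n nD.
  exact: (@leq_bigmax_seq _ _ xpredT id).
have gN x : (1 - e <= g N x)%R.
  have [n nD /ltW gn] := DX x I.
  by apply: le_trans gn _; apply: mg; exact: DN.
rewrite -leeBlDr//; apply: le_trans (riesz_cost_ge g N).
rewrite -EFinB lee_fin -(state_cst sL (1 - e)%R); apply: state_le => //.
exact: continuous_cst_fun.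
Qed.

Lemma riesz_outer_sigma_subadditive : sigma_subadditive riesz_outer.
Proof.
move=> F; suff add2e (e : {posnum R}) :
    riesz_outer (\bigcup_n F n) <= \sum_(i <oo) riesz_outer (F i) + e%:num%:E.
  by apply/lee_addgt0Pr => _/posnumP[].
rewrite (le_trans _ (epsilon_trick _ _ _))//; last first.
  by move=> n; exact: riesz_outer_ge0.
have [G PG] : {G : nat -> nat -> X -> R & forall i, riesz_cover (F i) (G i) /\
    riesz_cost (G i) <= riesz_outer (F i) + (e%:num / (2 ^ i.+1)%:R)%:E}.
  apply: (@choice _ _ (fun i g => riesz_cover (F i) g /\
    riesz_cost g <= riesz_outer (F i) + (e%:num / (2 ^ i.+1)%:R)%:E)) => i.
  have e0 : (0 < e%:num / (2 ^ i.+1)%:R)%R by [].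
  have [_ [g Fg <-] /ltW ge] := lb_ereal_inf_adherent e0 (riesz_outer_fin (F i)).
  by exists g.
(* Diagonal sum of the near-optimal covers: at stage [n] the first [n + 1] of them are taken at the
   same index, so [g n] is a finite sum over which [L] distributes. *)
pose g n x := (\sum_(i < n.+1) G i n x)%R.
apply: (@le_trans _ _ (riesz_cost g)).
  apply: riesz_outer_le; split => [n|n x|x m n mn|x [i _ Fix]].
  - by apply: continuous_sum_fun => i; have [[]] := PG i.
  - by apply: sumr_ge0 => i _; have [[_ + _ _] _] := PG i; apply.
  - rewrite /g (big_ord_widen _ (fun i => G i m x) (_ : m.+1 <= n.+1)%N)//.
    rewrite big_mkcond/=; apply: ler_sum => i _; have [[_ G0 + _] _] := PG i.
    by case: ifP => // _ mG; exact: mG.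
  - have [[_ G0 mG /(_ _ Fix)[n Gn]] _] := PG i.
    exists (maxn i n); rewrite /g.
    have im : (i < (maxn i n).+1)%N by rewrite ltnS leq_maxl.
    rewrite (bigD1 (Ordinal im))//= -[leLHS]addr0 lerD//.
      by apply: le_trans Gn _; apply: mG; exact: leq_maxr.
    by apply: sumr_ge0 => j _; have [[_ + _ _] _] := PG j; apply.
apply: ge_ereal_sup => _ [n _ <-].
rewrite /g (@state_sum _ _ _ sL); last first.
  by move=> i; have [[+ _ _ _] _] := PG i.
rewrite -sumEFin; apply: (@le_trans _ _ (\sum_(0 <= i < n.+1)
    (riesz_outer (F i) + (e%:num / (2 ^ i.+1)%:R)%:E))).
  rewrite big_mkord; apply: lee_sum => i _; have [_] := PG i; apply: le_trans.
  exact: riesz_cost_ge.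
apply: nneseries_lim_ge => i _.
by rewrite adde_ge0// riesz_outer_ge0.
Qed.

HB.instance Definition _ := isOuterMeasure.Build R X riesz_outer
  riesz_outer0 riesz_outer_ge0 le_riesz_outer riesz_outer_sigma_subadditive.

(* With [phi n] increasing to the indicator of [U], a cover [g] of [A] splits into
   the cover [g n * phi n] of [A `&` U] and, for each fixed [m], the cover
   [g n * (1 - phi m)] of [A `&` ~` U]. *)
Lemma open_caratheodory (U : set X) : open U -> riesz_outer.-caratheodory U.
Proof.
move=> /open_support[h [ch h0 h1 Uh]].
apply: le_caratheodory_measurable => A.
apply: le_ereal_inf_tmp => _ [g gA <-]; have [cg g0 mg Ag] := gA.
pose phi n x := Num.min (n%:R * h x)%R 1%R.
have cphi n : continuous (phi n).
  apply: continuous_min_fun; [exact: continuousZ_fun|exact: continuous_cst_fun].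
have phi0 n x : (0 <= phi n x)%R by rewrite le_min mulr_ge0// ler01.
have phi1 n x : (phi n x <= 1)%R by rewrite ge_min lexx orbT.
have mphi x : {homo (fun n => phi n x) : m n / (m <= n)%N >-> (m <= n)%R}.
  by move=> m n mn; rewrite le_min2// ler_wpM2r// ler_nat.
have [->|] := eqVneq (riesz_cost g) +oo; first by rewrite leey.
rewrite -ltey => gy; have gfin : riesz_cost g \is a fin_num.
  by rewrite ge0_fin_numE// (riesz_cost_ge0 gA).
have nU m : riesz_outer (A `&` ~` U) + (L (fun x => g m x * phi m x)%R)%:E <=
    riesz_cost g.
  rewrite -leeBrDr//; apply: (@le_trans _ _
      (riesz_cost (fun n x => g (m + n)%N x * (1 - phi m x))%R)).
    apply: riesz_outer_le; split => [n|n x|x p q pq|x [Ax nUx]].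
    - apply: continuousM_fun => //; apply: continuousB_fun => //.
      exact: continuous_cst_fun.
    - by rewrite mulr_ge0// subr_ge0.
    - by rewrite ler_wpM2r ?subr_ge0// mg// leq_add2l.
    - have hx : (h x = 0)%R.
        by apply/eqP; rewrite eq_le h0 andbT leNgt; apply/negP => /Uh.
      have [n gn] := Ag x Ax; exists n.
      rewrite /phi hx mulr0 min_l// subr0 mulr1; apply: le_trans gn _.
      by apply: mg; exact: leq_addl.
  apply: ge_ereal_sup => _ [n _ <-].
  rewrite leeBrDr// -EFinD; apply: le_trans (riesz_cost_ge g (m + n)).
  rewrite lee_fin -lerBrDr -stateB//; last exact: continuousM_fun.
  apply: state_le => //.
  - apply: continuousM_fun => //; apply: continuousB_fun => //.
    exact: continuous_cst_fun.
  - by apply: continuousB_fun => //; exact: continuousM_fun.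
  - move=> x; rewrite mulrBr mulr1 lerD2l lerN2 ler_wpM2r//.
    by apply: mg; exact: leq_addr.
(* Only the second summand of [nU] depends on [m]; its supremum over [m] is the cost of the cover
   [g n * phi n] of the part of [A] inside [U]. *)
rewrite -leeBrDr ?riesz_outer_fin//.
apply: (@le_trans _ _ (riesz_cost (fun n x => g n x * phi n x)%R)).
  apply: riesz_outer_le; split => [n|n x|x p q pq|x [Ax /Uh hx]].
  - exact: continuousM_fun.
  - by rewrite mulr_ge0.
  - by rewrite ler_pM// ?mg// mphi.
  - have [n gn] := Ag x Ax.
    have [p ph] : exists p, (1 <= p%:R * h x)%R.
      have /archi_boundP : (0 <= (h x)^-1)%R by rewrite invr_ge0 h0.
      by move=> /ltW hb; exists (Num.bound (h x)^-1); rewrite -ler_pdivrMr// mul1r.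
    exists (maxn n p); rewrite -[leLHS]mulr1 ler_pM//.
      by apply: le_trans gn _; apply: mg; exact: leq_maxl.
    rewrite le_min lexx andbT; apply: le_trans ph _.
    by rewrite ler_wpM2r// ler_nat leq_maxr.
apply: ge_ereal_sup => _ [n _ <-].
by rewrite leeBrDr ?riesz_outer_fin// addeC.
Qed.


Lemma borel_caratheodory (A : set (borelType X)) :
  measurable A -> riesz_outer.-caratheodory A.
Proof.
apply: smallest_sub; last exact: open_caratheodory.
split; first exact: caratheodory_measurable_set0.
- by move=> B mB; rewrite setTD; exact: caratheodory_measurable_setC.
- exact: caratheodory_measurable_bigcup.
Qed.

Definition riesz_measure (A : set (borelType X)) : \bar R := riesz_outer A.

Let riesz_measure_sigma_additive : semi_sigma_additive riesz_measure.
Proof.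
move=> F mF tF mUF.
by apply: (@caratheodory_measure_sigma_additive R X riesz_outer) => // [i|];
  exact: borel_caratheodory.
Qed.

HB.instance Definition _ := isMeasure.Build _ (borelType X) R riesz_measure
  riesz_outer0 riesz_outer_ge0 riesz_measure_sigma_additive.

HB.instance Definition _ :=
  Measure_isProbability.Build _ _ _ riesz_measure riesz_outerT.

Let mu : borel_prob R X := to_borel_prob riesz_measure.

Let muE (A : set (borelType X)) : measurable A -> mu A = riesz_outer A.
Proof. by move=> mA; rewrite /= borel_restrE. Qed.

Local Close Scope ereal_scope.

Let sI := integral_state compactX mu.

Let cmin f (a : R) : continuous f -> continuous (fun x : X => Num.min (f x) a).
Proof.
by move=> cf; apply: continuous_min_fun => //; exact: continuous_cst_fun.
Qed.

Let gt_measurable f (a : R) : continuous f ->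
  measurable ([set x | a < f x] : set (borelType X)).
Proof.
by move=> cf; apply: sub_sigma_algebra; exact: continuous_gt_open.
Qed.

(* The next two bounds compare the layers [min (f, a + h) - min (f, a)] of [f] for
   [L] and for the integral; shifting by one layer makes them telescope. *)
Let riesz_layer_le f a h : continuous f -> 0 < h ->
  h * fine (mu [set x | a + h < f x]) <=
  L (fun x => Num.min (f x) (a + h)) - L (fun x => Num.min (f x) a).
Proof.
move=> cf h0; rewrite mulrC -ler_pdivlMr// mulrC.
have cB := continuousB_fun (@cmin f (a + h) cf) (@cmin f a cf).
have [_ _ LZ _] := sL; rewrite -stateB//; try exact: cmin.
rewrite -LZ// -lee_fin fineK; last first.
  by apply: fin_num_measure; exact: gt_measurable.
rewrite muE; last exact: gt_measurable.
apply: riesz_outer_cst => [|x|x /= ahf].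
- exact: continuousZ_fun.
- rewrite mulr_ge0 ?invr_ge0 ?(ltW h0)// subr_ge0 le_min2// lerDl; exact: ltW.
- rewrite (min_r (ltW ahf)) min_r; last by rewrite ltW// (lt_trans _ ahf)// ltrDl.
  by rewrite addrAC subrr add0r mulVf// gt_eqF.
Qed.

Let integral_layer_le f b h : continuous f -> 0 < h ->
  \int[mu]_x Num.min (f x) (b + h) - \int[mu]_x Num.min (f x) b <=
  h * fine (mu [set x | b < f x]).
Proof.
move=> cf h0; rewrite -(stateB sI); try exact: cmin.
rewrite -Rintegral_cst; last exact: gt_measurable.
rewrite [leRHS]Rintegral_mkcond; apply: le_Rintegral => //.
- apply: (continuous_integrable compactX).
  by apply: continuousB_fun; exact: cmin.
- rewrite -restrict_EFin; have mA := @gt_measurable f b cf.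
  apply/(@integrable_mkcond _ (borelType X) R mu _ (fun=> h%:E) mA).
  exact: finite_measure_integrable_cst.
- move=> x _; rewrite patchE; case: ifPn => [|].
    rewrite in_setE /= => bf; rewrite (min_r (ltW bf)) lerBlDl.
    by rewrite ge_min lexx orbT.
  rewrite notin_setE /= => /negP; rewrite -leNgt => fb.
  by rewrite !min_l ?subrr// (le_trans fb)// lerDl ltW.
Qed.

(** The integral of the layer from [b] to [b + h] is at most [h] times the mass of [b < f], hence at
    most the value of [L] on the layer just below. Summing over layers loses only the lowest one,
    whose contribution is at most [h]. *)
Let integral_le_state f : continuous f -> (forall x, 0 <= f x) ->
  (forall x, f x <= 1) -> \int[mu]_x f x <= L f.
Proof.
move=> cf f0 f1; apply/ler_addgt0Pl => e e0.
(* With this step, level [N + 1] is exactly 1 and truncation there leaves [f] unchanged; [N] exceeds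
   [1 / e], whence [h <= e]. *)
pose N := Num.bound e^-1; pose h : R := N.+1%:R^-1.
have h0 : 0 < h by rewrite invr_gt0.
have he : h <= e.
  rewrite /h -[leRHS]invrK lef_pV2 ?posrE ?invr_gt0//.
  have /archi_boundP/ltW/le_trans : 0 <= e^-1 by rewrite invr_ge0 ltW.
  by apply; rewrite ler_nat.
have ind n : \int[mu]_x Num.min (f x) (n%:R * h + h) <=
    h + L (fun x => Num.min (f x) (n%:R * h)).
  elim: n => [|n ih].
    apply: (@le_trans _ _ h).
      rewrite -[leRHS](state_cst sI) mul0r add0r; apply: (state_le sI).
      - exact: cmin.
      - exact: continuous_cst_fun.
      - by move=> x; rewrite ge_min lexx orbT.
    by rewrite lerDl mul0r; have [_ _ _] := sL; apply => [|x];
      [exact: cmin|rewrite le_min f0 lexx].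
  have := @integral_layer_le f (n%:R * h + h) h cf h0.
  have := @riesz_layer_le f (n%:R * h) h cf h0.
  rewrite -natr1 mulrDl mul1r; lra.
have := ind N.+1; rewrite /h mulfV ?pnatr_eq0//.
rewrite (_ : (fun x => Num.min (f x) 1) = f); last first.
  by apply/funext => x; rewrite min_l.
rewrite [X in Rintegral _ _ X](_ : _ = f); last first.
  by apply/funext => x; rewrite min_l// (le_trans (f1 x))// lerDl invr_ge0.
by move/le_trans; apply; rewrite lerD2r.
Qed.

(** For [0 <= g <= 1] the one-sided bound applied to [g] and to [1 - g] gives equality; a general
    [f] is moved into this range by an affine map. *)
Lemma riesz_representation : exists nu : borel_prob R X,
  forall f, continuous f -> \int[nu]_x f x = L f.
Proof.
exists mu => f cf.
have unit_eq (g : X -> R) : continuous g -> (forall x, 0 <= g x) ->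
    (forall x, g x <= 1) -> \int[mu]_x g x = L g.
  move=> cg g0 g1; apply/eqP; rewrite eq_le integral_le_state//=.
  have c1 : continuous (fun _ : X => 1 : R) by exact: continuous_cst_fun.
  have := @integral_le_state (fun x => 1 - g x).
  rewrite (stateB sL)// (stateB sI)// (state_cst sL) (state_cst sI) lerD2l lerN2.
  apply => [|x|x]; first exact: continuousB_fun.
    by rewrite subr_ge0.
  by rewrite gerBl.
have [M M0 fM] := compact_continuous_bounded compactX cf.
(* [f + M] takes values between 0 and [2 M]; the extra 1 keeps [c] positive when [M = 0]. *)
pose c := (M + M + 1)^-1; have c0 : 0 < c by rewrite invr_gt0 ltr_wpDl// addr_ge0.
have cM : continuous (fun x => f x + M).
  by apply: continuousD_fun => //; exact: continuous_cst_fun.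
have [_ LD LZ _] := sL; have [_ ID IZ _] := sI.
have := unit_eq (fun x => c * (f x + M)).
rewrite LZ// IZ// LD//; last exact: continuous_cst_fun.
rewrite ID//; last exact: continuous_cst_fun.
rewrite (state_cst sL) (state_cst sI) => /(_ (continuousZ_fun cM)) H.
have {}/H H : forall x, 0 <= c * (f x + M).
  move=> x; rewrite mulr_ge0 ?(ltW c0)//.
  by have := fM x; rewrite ler_norml => /andP[? _]; lra.
have {}/H H : forall x, c * (f x + M) <= 1.
  move=> x; rewrite mulrC ler_pdivrMr ?mul1r; last by rewrite ltr_wpDl// addr_ge0.
  by have := fM x; rewrite ler_norml => /andP[_ ?]; lra.
by apply: (addIr M); apply: (mulfI (lt0r_neq0 c0)).
Qed.

End riesz.

(** * Borel probability measures and continuous functions *)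

Section measure_integral_comparison.
Context (R : realType) (X : ptopologicalType).
Hypothesis compactX : compact [set: X].
Implicit Types (mu : borel_prob R X) (f : X -> R) (U : set X).

Lemma integral_indic_measure mu (A : set (borelType X)) : measurable A ->
  \int[mu]_x \1_A x = fine (mu A).
Proof. by move=> mA; rewrite /Rintegral integral_indic// setIT. Qed.

Lemma borel_integrable_indic mu (A : set (borelType X)) : measurable A ->
  mu.-integrable [set: borelType X] (fun x => (\1_A x)%:E).
Proof.
by move=> mA; exact: integrable_indic.
Qed.

Lemma integral_le_measure mu f (A : set (borelType X)) : measurable A ->
  continuous f -> (forall x, f x <= \1_A x) -> \int[mu]_x f x <= fine (mu A).
Proof.
move=> mA cf fA; rewrite -integral_indic_measure//.
apply: le_Rintegral => //; first exact: continuous_integrable.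
exact: borel_integrable_indic.
Qed.

Lemma measure_le_integral mu f (A : set (borelType X)) : measurable A ->
  continuous f -> (forall x, \1_A x <= f x) -> fine (mu A) <= \int[mu]_x f x.
Proof.
move=> mA cf fA; rewrite -integral_indic_measure//.
apply: le_Rintegral => //; last exact: continuous_integrable.
exact: borel_integrable_indic.
Qed.

Lemma open_borel U : open U -> measurable (U : set (borelType X)).
Proof. by move=> oU; exact: sub_sigma_algebra. Qed.

Lemma measure_setC_lt mu U e : open U ->
  (mu (~` U) < e%:E)%E = (1 - e < fine (mu U)).
Proof.
move=> oU; have mU := open_borel oU.
rewrite probability_setC// -(fineK (fin_num_measure _ _ mU)) -EFinB lte_fin.
by rewrite ltrBlDr ltrBlDr addrC.
Qed.

End measure_integral_comparison.

Section test_functions.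
Context (R : realType) (X : pmetricType R).
Hypothesis compactX : compact [set: X].
Implicit Types (mu nu : borel_prob R X) (f g : X -> R) (A U : set X).

Lemma open_bump U : open U -> U !=set0 -> exists f : X -> R,
  [/\ continuous f, forall x, 0 <= f x, forall x, f x <= \1_U x
    & exists x, f x = 1].
Proof.
move=> oU [x0 /[dup] Ux0]; have [h [ch h0 _ Uh]] := open_support oU => /Uh hx0.
exists (fun x => Num.min ((h x0)^-1 * h x) 1); split => [|x|x|].
- by apply: continuous_min_fun; [exact: continuousZ_fun|exact: continuous_cst_fun].
- by rewrite le_min ler01 mulr_ge0 ?invr_ge0.
- rewrite indicE; have [_|] := boolP (x \in U); first by rewrite ge_min lexx orbT.
  rewrite notin_setE => nUx; rewrite ge_min; apply/orP; left.
  suff -> : h x = 0 by rewrite mulr0.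
  by apply/eqP; rewrite eq_le h0 andbT leNgt; apply/negP => /Uh.
- by exists x0; rewrite mulVf ?gt_eqF// minxx.
Qed.

(** [U] is the increasing union of the open sets [A n], so continuity from below gives one with mass
    above [c]; the cut-off of [n h] at 1 lies between the indicators of [A n] and of [U]. *)
Lemma open_inner_approx mu U (c : R) : open U -> (c%:E < mu U)%E ->
  exists f : X -> R, [/\ continuous f, forall x, 0 <= f x,
    forall x, f x <= \1_U x & c < \int[mu]_x f x].
Proof.
move=> oU cU; have [h [ch h0 h1 Uh]] := open_support oU.
pose A (n : nat) := [set x | 1 < n%:R * h x].
have oA n : open (A n) by apply: continuous_gt_open; exact: continuousZ_fun.
have UA : U = \bigcup_n A n.
  apply/seteqP; split => [x /Uh hx|x [n _] /= nx].
    have /archi_boundP : 0 <= (h x)^-1 by rewrite invr_ge0.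
    move=> hb; exists (Num.bound (h x)^-1) => //.
    by rewrite /A/= -ltr_pdivrMr// mul1r.
  apply/Uh; rewrite lt_neqAle h0 andbT; apply/eqP => hx.
  by move: nx; rewrite /A/= -hx mulr0 ltr10.
have cvgA : (fun n => mu (A n)) @ \oo --> mu U.
  rewrite UA; apply: nondecreasing_cvg_mu => //.
  - by move=> n; exact: open_borel.
  - by rewrite -UA; exact: open_borel.
  - move=> m n mn; apply/subsetPset => x /= /lt_le_trans; apply.
    by rewrite ler_wpM2r// ler_nat.
have [n cAn] : exists n, (c%:E < mu (A n))%E.
  have : \forall n \near \oo, (c%:E < mu (A n))%E.
    apply: (cvgA [set y | (c%:E < y)%E]); apply: open_nbhs_nbhs; split => //.
    exact: open_ereal_gt_ereal.
  by move=> [n _ /(_ n (leqnn n))]; exists n.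
exists (fun x => Num.min (n%:R * h x) 1).
have cf : continuous (fun x => Num.min (n%:R * h x) 1).
  by apply: continuous_min_fun; [exact: continuousZ_fun|exact: continuous_cst_fun].
split => // [x|x|].
- by rewrite le_min ler01 mulr_ge0.
- rewrite indicE; have [_|] := boolP (x \in U); first by rewrite ge_min lexx orbT.
  rewrite notin_setE => nUx; rewrite ge_min; apply/orP; left.
  suff -> : h x = 0 by rewrite mulr0.
  by apply/eqP; rewrite eq_le h0 andbT leNgt; apply/negP => /Uh.
- have mA := open_borel (oA n).
  apply: (@lt_le_trans _ _ (fine (mu (A n)))).
    by rewrite -lte_fin fineK// fin_num_measure.
  apply: measure_le_integral => // x; rewrite indicE.
  have [|_] := boolP (x \in A n); last by rewrite le_min ler01 mulr_ge0.
  by rewrite in_setE /A/= => nx; rewrite le_min lexx ltW.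
Qed.

(** Inner approximation by continuous functions gives equality on open sets, a generating family
    stable under intersection. *)
Lemma borel_prob_eq_integral mu nu :
  (forall f, continuous f -> \int[mu]_x f x = \int[nu]_x f x) -> mu = nu.
Proof.
have le1 mu1 nu1 : (forall f, continuous f -> \int[mu1]_x f x = \int[nu1]_x f x) ->
    forall U, open U -> (mu1 U <= nu1 U)%E.
  move=> E U oU; rewrite leNgt; apply/negP => lt.
  have nuU : nu1 U \is a fin_num by apply: fin_num_measure; exact: open_borel.
  have [f [cf f0 fU]] : exists f : X -> R, [/\ continuous f, forall x, 0 <= f x,
      forall x, f x <= \1_U x & fine (nu1 U) < \int[mu1]_x f x].
    by apply: open_inner_approx => //; rewrite fineK.
  by rewrite E// ltNge integral_le_measure//; exact: open_borel.
move=> E; apply: borel_prob_eq => A mA.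
apply: (@measure_unique _ R (borelType X) (@open X) (fun=> setT)) => //.
- by move=> U V; exact: openI.
- by move=> _; exact: openT.
- by rewrite bigcup_const.
- move=> U oU; apply/eqP; rewrite eq_le !le1// => f cf; by rewrite E.
- by move=> _; apply: le_lt_trans (probability_le1 _ _) (ltry _).
Qed.

End test_functions.

(** * Iterates of the map and of its push-forward *)

Section iterates.
Context (R : realType) (X : ptopologicalType) (T : continuousType X X).
Implicit Types mu : borel_prob R X.

Lemma continuous_iter k : continuous (iter k T).
Proof.
elim: k => [|k ih] x; first exact: cvg_id.
by apply: (@continuous_comp _ _ _ (iter k T) T); [exact: ih|exact: cts_fun].
Qed.

Lemma borel_preimage (S : X -> X) (A : set (borelType X)) : continuous S ->
  measurable A -> measurable (S @^-1` A : set (borelType X)).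
Proof.
by move=> cS mA; rewrite -[_ @^-1` _]setTI; exact: continuous_borel_measurable.
Qed.

Lemma iter_pushE k mu (A : set (borelType X)) : measurable A ->
  iter k (push T) mu A = mu (iter k T @^-1` A).
Proof.
elim: k A => [//|k ih] A mA; rewrite iterS pushE// ih//.
by apply: borel_preimage => //; exact: cts_fun.
Qed.

Lemma integral_iter_push k mu (f : X -> R) : continuous f ->
  \int[iter k (push T) mu]_x f x = \int[mu]_x f (iter k T x).
Proof.
elim: k f => [//|k ih] f cf; rewrite iterS.
have := integral_push T (iter k (push T) mu) (cts cf).
rewrite /integral_against/= => ->.
rewrite (ih (f \o T))// => x.
by apply: continuous_comp; [exact: cts_fun|exact: cf].
Qed.

End iterates.

(** * Compactness of the space of measures *)

Section weak_star.
Context (R : realType) (X : ptopologicalType).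
Local Notation M := (borel_prob R X).

Lemma cvg_weak_star (F : set_system M) (mu : M) : Filter F ->
  (forall f : continuousType X R,
     (fun nu : M => integral_against nu f) @ F --> integral_against mu f) ->
  F --> mu.
Proof.
move=> FF Fmu U [_ [[V oV <-] Vmu]] /filterS; apply.
suff : (@integral_against R X) @ F --> @integral_against R X mu.
  by apply; exact: open_nbhs_nbhs.
apply/cvg_sup => f U0 [_ [[W oW <-] Wmu]] /filterS; apply.
by apply: (Fmu f); exact: open_nbhs_nbhs.
Qed.

(** The sets [B] form a filter base, and this filter converges to [mu] because every single test
    function occurs with every tolerance; hence it contains each neighbourhood [W]. *)
Lemma nbhs_weak_star (mu : M) (W : set M) : nbhs mu W ->
  exists (fs : seq (continuousType X R)) (e : R), 0 < e /\
    forall nu : M,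
      \sum_(f <- fs) `|integral_against nu f - integral_against mu f| < e -> W nu.
Proof.
pose B (p : seq (continuousType X R) * R) : set M := [set nu |
  \sum_(f <- p.1) `|integral_against nu f - integral_against mu f| < p.2].
pose F := filter_from [set p : seq (continuousType X R) * R | 0 < p.2] B.
have FF : Filter F.
  apply: filter_from_filter; first by exists ([::], 1) => /=.
  move=> [fs e] [gs d] /= e0 d0; exists (fs ++ gs, Num.min e d).
    by rewrite /= lt_min e0.
  move=> nu; rewrite /B/= big_cat/= => lt.
  split; apply: le_lt_trans (lt_le_trans lt _).
  - by rewrite lerDl; apply: sumr_ge0.
  - by rewrite ge_min lexx.
  - by rewrite lerDr; apply: sumr_ge0.
  - by rewrite ge_min lexx orbT.
have FW : F --> mu.
  apply: cvg_weak_star => f; apply/cvgrPdist_lt => e e0.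
  exists ([:: f], e) => //= nu; rewrite /B/= big_seq1.
  by rewrite distrC.
by move=> /FW[[fs e] /= e0 BW]; exists fs, e; split.
Qed.

End weak_star.

Section compactness.
Context (R : realType) (X : pmetricType R).
Hypothesis compactX : compact [set: X].
Local Notation M := (borel_prob R X).

(** Along an ultrafilter the integrals of each continuous function converge, being bounded; the
    limits form a state, and the measure representing it is the limit of the ultrafilter. *)
Lemma compact_borel_prob : compact [set: M].
Proof.
rewrite compact_ultra => F UF _.
have PF : ProperFilter F := @ultra_proper _ _ UF.
pose G f : set_system R := (fun nu : M => \int[nu]_x f x : R) @ F.
have PG f : ProperFilter (G f) by exact: fmap_proper_filter.
have cvgG f : continuous f -> cvg (G f).
  move=> cf; have [C C0 fC] := compact_continuous_bounded compactX cf.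
  have [|p [_ clp]] := @segment_compact R (- C) C (G f) (PG f).
    apply: (@filterE _ F) => nu; rewrite /= in_itv/= -ler_norml.
    rewrite -[X in `|X|]subr0 -(state_cst (integral_state compactX nu) 0).
    apply: (state_dist_le (integral_state compactX nu)) => //.
      exact: continuous_cst_fun.
    by move=> x; rewrite subr0.
  (* For an ultrafilter a cluster point is already a limit. *)
  apply/cvg_ex; exists p => V pV.
  have [//|FnV] := in_ultra_setVsetC ((fun nu : M => \int[nu]_x f x : R) @^-1` V) UF.
  by have [y []] := clp (~` V) V FnV pV.
pose L f := lim (G f).
have LE f l : G f --> l -> L f = l by move=> Gl; exact: cvg_lim.
have sL : state L.
  split => [|f g cf cg|a f cf|f cf f0].
  - apply: LE; rewrite /G.
    rewrite (_ : (fun nu : M => _) = fun=> 1 : R); first exact: cvg_cst.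
    by apply/funext => nu; have [] := integral_state compactX nu.
  - apply: LE; rewrite /G.
    rewrite (_ : (fun nu : M => _) =
      (fun nu : M => \int[nu]_x f x + \int[nu]_x g x : R)).
      by apply: cvgD; exact: cvgG.
    by apply/funext => nu; have [_ -> //] := integral_state compactX nu.
  - apply: LE; rewrite /G.
    rewrite (_ : (fun nu : M => _) = (fun nu : M => a * \int[nu]_x f x : R)).
      by apply: cvgM; [exact: cvg_cst|exact: cvgG].
    by apply/funext => nu; have [_ _ -> //] := integral_state compactX nu.
  - apply: limr_ge; first exact: cvgG.
    by apply: nearW => nu; exact: Rintegral_ge0.
have [mu muL] := riesz_representation compactX sL.
exists mu; split => //; apply: cvg_weak_star => f.
rewrite /integral_against muL//; last exact: cts_fun.
by apply: cvgG; exact: cts_fun.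
Qed.

End compactness.

(** * Extreme points and ergodic measures *)

Section faces.
Context (R : realType) (X : pmetricType R).
Hypothesis compactX : compact [set: X].
Local Notation M := (borel_prob R X).
Implicit Types (mu nu : M) (F G I : set M) (t : R).

Definition convex_comb t mu nu1 nu2 : Prop :=
  forall A : set (borelType X), measurable A ->
    mu A = (t%:E * nu1 A + (1 - t)%:E * nu2 A)%E.

Lemma convex_combC t mu nu1 nu2 :
  convex_comb t mu nu1 nu2 -> convex_comb (1 - t) mu nu2 nu1.
Proof. by move=> c A /c ->; rewrite subKr addeC. Qed.

Lemma integral_convex_comb t mu nu1 nu2 (f : X -> R) : 0 < t < 1 ->
  convex_comb t mu nu1 nu2 -> continuous f ->
  \int[mu]_x f x = t * \int[nu1]_x f x + (1 - t) * \int[nu2]_x f x.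
Proof.
move=> /andP[t0 t1] c cf.
(* Additivity in the measure is used for nonnegative integrands; a general [f] is first shifted by a
   bound [C]. *)
wlog f0 : f cf / forall x, 0 <= f x => [ge0|].
  have [C C0 fC] := compact_continuous_bounded compactX cf.
  have cC := @continuous_cst_fun R X C.
  have := ge0 (fun x => f x + C) (continuousD_fun cf cC).
  have ID nu : \int[nu]_x (f x + C) = \int[nu]_x f x + C.
    have sI := integral_state compactX nu; rewrite -[X in _ = _ + X](state_cst sI).
    by have [_ -> //] := sI.
  rewrite !ID => H; have {}/H : forall x, 0 <= f x + C.
    by move=> x; have := fC x; rewrite ler_norml => /andP[? _]; lra.
  lra.
pose s := NngNum (ltW t0).
have t1' : 0 <= 1 - t by rewrite subr_ge0 ltW.
pose r := NngNum t1'.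
have mf : measurable_fun [set: borelType X] (fun x => (f x)%:E).
  by apply/measurable_EFinP; exact: continuous_real_measurable.
have f0E (x : borelType X) : setT x -> (0 <= (f x)%:E)%E by rewrite lee_fin.
have fin nu : (\int[nu]_x (f x)%:E)%E \is a fin_num.
  by apply: integrable_fin_num => //; exact: continuous_integrable.
rewrite /Rintegral (eq_measure_integral
  (measure_add (mscale s nu1) (mscale r nu2))); last first.
  move=> A mA _; apply: etrans (c A mA) _.
  exact/esym/(measure_addE (mscale s nu1) (mscale r nu2) A).
rewrite ge0_integral_measure_add// !ge0_integral_mscale//.
have fM (q : R) nu : (q%:E * \int[nu]_x (f x)%:E)%E \is a fin_num.
  by rewrite fin_numM.
by rewrite (fineD (fM _ _) (fM _ _)) (fineM _ (fin nu1))// (fineM _ (fin nu2)).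
Qed.

(** Closed extreme subsets of [I]. Concluding for [nu1] alone suffices, as [convex_combC] exchanges
    the two components. *)
Definition face I F : Prop :=
  [/\ F !=set0, closed F, F `<=` I
    & forall t mu nu1 nu2, F mu -> I nu1 -> I nu2 -> 0 < t < 1 ->
        convex_comb t mu nu1 nu2 -> F nu1].

Lemma continuous_integral (f : X -> R) : continuous f ->
  continuous (fun mu : M => \int[mu]_x f x : R).
Proof. by move=> cf; exact: (@integral_against_continuous R X (cts cf)). Qed.

Definition argmax_integral F (f : X -> R) : set M :=
  [set mu | F mu /\ forall nu, F nu -> \int[nu]_x f x <= \int[mu]_x f x].

(** If a convex combination of two values, neither above the maximum, attains the maximum, then both
    values do. *)
Lemma argmax_face I F (f : X -> R) : face I F -> continuous f ->
  face I (argmax_integral F f).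
Proof.
move=> [F0 clF FI extF] cf.
have cI := continuous_integral cf.
split.
- have cF : compact F.
    exact: (subclosed_compact clF (compact_borel_prob compactX)).
  have [mu Fmu maxmu] := compact_EVT_max F0 cF (continuous_subspaceT cI).
  exists mu; split => [|nu Fnu]; first by rewrite in_setE in Fmu.
  by apply: maxmu; rewrite in_setE.
- rewrite (_ : argmax_integral F f = F `&` \bigcap_(nu in F)
      ((fun mu : M => \int[mu]_x f x : R) @^-1` [set r | \int[nu]_x f x <= r])).
    apply: closedI => //; apply: closed_bigI => nu Fnu.
    by apply: closed_comp; [move=> mu _; exact: cI|exact: closed_ge].
  by apply/seteqP; split => mu [Fmu H]; split.
- by move=> mu [/FI].
- move=> t mu nu1 nu2 [Fmu maxmu] I1 I2 /[dup] t01 /andP[t0 t1] c.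
  have F1 : F nu1 by exact: (extF t mu nu1 nu2).
  have F2 : F nu2.
    apply: (extF (1 - t) mu nu2 nu1) => //; last exact: convex_combC.
    by rewrite subr_gt0 t1 gtrBl.
  split => // nu /maxmu /le_trans; apply.
  have := maxmu _ F2; rewrite (integral_convex_comb t01 c cf).
  set a := \int[nu1]_x f x; set b := \int[nu2]_x f x => ba.
  by rewrite -subr_ge0 -(pmulr_rge0 _ t0); nra.
Qed.

(** Zorn's lemma for faces under reverse inclusion. The intersection of a nonempty chain is nonempty
    by compactness: it contains a cluster point of the filter generated by the chain. *)
Lemma minimal_face I F0 : face I F0 ->
  exists F, [/\ face I F, F `<=` F0 & forall G, face I G -> G `<=` F -> F `<=` G].
Proof.
move=> faceF0.
pose K := {F : set M | face I F /\ F `<=` F0}.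
pose k0 : K := exist _ F0 (conj faceF0 (@subset_refl _ F0)).
pose le (F G : K) := `[< sval G `<=` sval F >].
have [||C totC|[F [faceF FF0]] minF] := @ZL_preorder K k0 le.
- by move=> F; apply/asboolP.
- by move=> G F H /asboolP FG /asboolP GH; apply/asboolP => x /GH/FG.
- have [C0|/set0P[c Cc]] := eqVneq C set0; first by exists k0 => F; rewrite C0.
  pose D := \bigcap_(F in C) sval F.
  suff D0 : D !=set0.
    have faceD : face I D.
      split => //.
      + by apply: closed_bigI => F _; have [[]] := svalP F.
      + by move=> mu /(_ c Cc); have [[_ _ + _] _] := svalP c; apply.
      + move=> t mu nu1 nu2 Dmu I1 I2 t01 cc F CF.
        have [[_ _ _ ext] _] := svalP F.
        by apply: (ext t mu nu1 nu2) => //; exact: Dmu.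
    have DF0 : D `<=` F0 by move=> mu /(_ c Cc); have [_] := svalP c; apply.
    by exists (exist _ D (conj faceD DF0)) => F CF; apply/asboolP => mu; apply.
  pose Fl := filter_from C (fun F : K => sval F).
  have PFl : ProperFilter Fl.
    apply: filter_from_proper; last by move=> F _; have [[]] := svalP F.
    apply: filter_from_filter; first by exists c.
    move=> F G CF CG; have [/asboolP GF|/asboolP FG] := totC F G CF CG.
      by exists G => // mu Gmu; split => //; exact: GF.
    by exists F => // mu Fmu; split => //; exact: FG.
  have [|mu [_]] := compact_borel_prob compactX PFl; first exact: filterT.
  rewrite clusterE => clmu; exists mu => F CF.
  have [[_ clF _ _] _] := svalP F; rewrite closure_id in clF; rewrite clF.
  by apply: clmu; exists F.
exists F; split => // G faceG GF.
have GF0 : G `<=` F0 by exact: subset_trans GF FF0.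
have /asboolP := minF (exist _ G (conj faceG GF0)) (introT (asboolP _) GF).
by [].
Qed.

(** The Krein-Milman argument: on a minimal face every continuous [f] has constant integral, since
    the maximizers form a smaller face; as integrals separate measures, that face is a single
    point. *)
Lemma extreme_point I F0 : face I F0 -> exists2 mu, F0 mu &
  forall t nu1 nu2, I nu1 -> I nu2 -> 0 < t < 1 -> convex_comb t mu nu1 nu2 ->
    nu1 = mu.
Proof.
move=> /minimal_face[F [faceF FF0 minF]]; have [[mu Fmu] _ _ ext] := faceF.
exists mu; first exact: FF0.
move=> t nu1 nu2 I1 I2 t01 c; have F1 : F nu1 by exact: (ext t mu nu1 nu2).
apply: (borel_prob_eq_integral compactX) => f cf; apply/eqP.
have minFf := minF _ (argmax_face faceF cf) (fun mu => @proj1 _ _).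
by rewrite eq_le (minFf _ Fmu).2// (minFf _ F1).2.
Qed.

End faces.

Section ergodic.
Context (R : realType) (X : pmetricType R) (T : continuousType X X) (k : nat).
Hypothesis compactX : compact [set: X].
Local Notation M := (borel_prob R X).
Local Notation S := (iter k T).
Local Notation invariant := [set mu : M | iter k (push T) mu = mu].
Implicit Types mu nu : M.

Lemma invariantP mu : invariant mu <->
  forall A : set (borelType X), measurable A -> mu (S @^-1` A) = mu A.
Proof.
split => [inv A mA|inv]; first by rewrite -iter_pushE// inv.
by apply: borel_prob_eq => A mA; rewrite iter_pushE// inv.
Qed.

(** Invariance is tested on continuous functions, each test being a closed condition. *)
Lemma closed_invariant : closed invariant.
Proof.
pose D (f : continuousType X R) (mu : M) : R :=
  \int[mu]_x f (S x) - \int[mu]_x f x.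
have cD f : continuous (D f).
  apply: continuousB_fun; apply: continuous_integral; last exact: cts_fun.
  move=> x; apply: continuous_comp; last exact: cts_fun.
  exact: continuous_iter.
rewrite (_ : invariant = \bigcap_f (D f @^-1` [set 0])).
  apply: closed_bigI => f _.
  by apply: closed_comp => [mu _|]; [exact: cD|exact: closed_eq].
apply/seteqP; split => mu /= H.
  move=> f _; rewrite /D/= -(integral_iter_push T k mu); last exact: cts_fun.
  by rewrite H subrr.
apply: (borel_prob_eq_integral compactX) => f cf.
have /eqP := H (cts cf) I; rewrite /D subr_eq0 => /eqP/= <-.
by rewrite integral_iter_push.
Qed.

(** Conditioning of [mu] on [A]; if [mu A = 0] the normalization returns [mu] itself, which is why
    the lemmas below assume [mu A != 0]. *)
Definition cond_prob mu (A : set (borelType X)) (mA : measurable A) : M :=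
  to_borel_prob (mnormalize (mrestr mu mA) mu).

Lemma cond_probE mu (A B : set (borelType X)) (mA : measurable A) :
  measurable B -> mu A != 0%E ->
  cond_prob mu mA B = (mu (B `&` A) * ((fine (mu A))^-1)%:E)%E.
Proof.
move=> mB A0; rewrite /= borel_restrE//.
have AE : mrestr mu mA setT = mu A by rewrite /mrestr setTI.
transitivity (if (mrestr mu mA setT == 0) || (mrestr mu mA setT == +oo) then mu B
  else mrestr mu mA B * (fine (mrestr mu mA setT))^-1%:E)%E.
  by rewrite -[LHS]/(mnormalize (mrestr mu mA) mu B) /mnormalize; case: ifP.
rewrite AE.
have -> : (mu A == 0%E) || (mu A == +oo%E) = false.
  apply/negbTE; rewrite negb_or A0/= -ltey.
  exact: le_lt_trans (probability_le1 _ _) (ltry _).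
by [].
Qed.

Lemma cond_prob_invariant mu (A : set (borelType X)) (mA : measurable A) :
  invariant mu -> S @^-1` A = A -> mu A != 0%E -> invariant (cond_prob mu mA).
Proof.
move=> /invariantP inv SA A0; apply/invariantP => B mB.
have mSB : measurable (S @^-1` B : set (borelType X)).
  by apply: borel_preimage => //; exact: continuous_iter.
rewrite !cond_probE//; congr (_ * _)%E.
by rewrite -[in LHS]SA -preimage_setI inv//; exact: measurableI.
Qed.

Lemma cond_prob_convex_comb mu (A : set (borelType X)) (mA : measurable A) :
  mu A != 0%E -> mu A != 1%E ->
  convex_comb (fine (mu A)) mu (cond_prob mu mA) (cond_prob mu (measurableC mA)).
Proof.
move=> A0 A1 B mB.
have fin C : measurable C -> mu C \is a fin_num by exact: fin_num_measure.
have muC : mu (~` A) = (1 - fine (mu A))%:E.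
  by rewrite probability_setC// EFinB fineK// fin.
have fA0 : fine (mu A) != 0 by rewrite fine_eq0// fin.
have fC0 : 1 - fine (mu A) != 0.
  by rewrite subr_eq0 eq_sym -eqe fineK// fin.
rewrite !cond_probE//; last by rewrite muC eqe.
rewrite muC/= ![(_%:E * (mu _ * _))%E]muleCA -!EFinM !divff// !mule1.
rewrite -measureU//.
- by rewrite -setIUr setUv setIT.
- exact: measurableI.
- by apply: measurableI => //; exact: measurableC.
- by rewrite setIACA setICr setI0.
Qed.

(** The extreme point is taken inside the face of maximizers, so that the integral of [f] does not
    decrease. *)
Lemma exists_ergodic mu (f : X -> R) : iter k (push T) mu = mu ->
  continuous f -> exists2 nu : M, ergodic_measures S nu &
    \int[mu]_x f x <= \int[nu]_x f x.
Proof.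
move=> inv cf.
have face_inv : face invariant invariant.
  by split => //; [exists mu|exact: closed_invariant].
have [nu [nuI numax] nuext] :=
  extreme_point compactX (argmax_face compactX face_inv cf).
exists nu; last exact: numax.
split; first exact/invariantP.
move=> A mA SA; have [|A0] := eqVneq (nu A) 0%E; first by left.
right; apply/eqP; apply: contraT => A1.
have fin C : measurable C -> nu C \is a fin_num by exact: fin_num_measure.
have C0 : nu (~` A) != 0%E.
  by rewrite probability_setC// -(fineK (fin _ mA)) -EFinB eqe subr_eq0 eq_sym
    -eqe fineK ?fin.
(* An invariant [A] of mass strictly between 0 and 1 splits [nu] into two conditional measures;
   extremality identifies the first with [nu], and evaluation at [A] then gives [nu A = 1]. *)
have E : cond_prob nu mA = nu.
  apply: (nuext (fine (nu A)) _ (cond_prob nu (measurableC mA))).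
  - exact: cond_prob_invariant.
  - by apply: cond_prob_invariant => //; rewrite -[in RHS]SA.
  - rewrite -!lte_fin fineK ?fin// lt_neqAle eq_sym A0 measure_ge0/=.
    by rewrite lt_neqAle probability_le1// andbT.
  - exact: cond_prob_convex_comb.
have nuA : (nu A * ((fine (nu A))^-1)%:E = 1)%E.
  by rewrite -{1}(fineK (fin _ mA)) -EFinM divff// fine_eq0// fin.
have := cond_probE mA mA A0; rewrite E setIid nuA => A1'.
by rewrite A1' eqxx in A1.
Qed.

End ergodic.

(** * Weak mixing *)

Lemma infinite_nat_setP (A : set nat) :
  infinite_set A <-> forall m, exists2 n, A n & (m <= n)%N.
Proof.
split=> [infA m|unbA].
  have [n [An nm]] := infinite_setN0 (infinite_setD infA (finite_II m)).
  by exists n => //; rewrite leqNgt; apply/negP.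
move=> /finite_fsetP[F AF].
have [n] := unbA (\max_(i <- finmap.enum_fset F) i).+1.
by rewrite AF /= => nF; rewrite ltnNge (@leq_bigmax_seq _ _ xpredT id).
Qed.

Section hitting_times.
Context (X : ptopologicalType) (T : continuousType X X).
Hypothesis surjT : set_surj [set: X] [set: X] T.
Local Notation N := (hitting_times T).
Implicit Types U V W : set X.

Lemma open_iter_preimage k U : open U -> open (iter k T @^-1` U).
Proof. by have /continuousP := @continuous_iter X T k; apply. Qed.

Lemma iter_preimage_nonempty k U : U !=set0 -> iter k T @^-1` U !=set0.
Proof.
elim: k U => [//|k ih] U [x Ux]; have [y _ yx] := surjT (I : setT x).
have [|z zy] := ih [set y]; first by exists y.
by exists z; rewrite /= zy yx.
Qed.

Lemma weakly_mixingP : weakly_mixing T <->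
  forall U1 V1 U2 V2, open U1 -> open V1 -> open U2 -> open V2 ->
    U1 !=set0 -> V1 !=set0 -> U2 !=set0 -> V2 !=set0 ->
    infinite_set (N U1 V1 `&` N U2 V2).
Proof.
have iterTT n (p : X * X) :
    iter n (fun p : X * X => (T p.1, T p.2)) p = (iter n T p.1, iter n T p.2).
  by elim: n => [|n ih]; [case: p|rewrite iterS ih].
have openX (A B : set X) : open A -> open B -> open (A `*` B).
  move=> oA oB; rewrite openE => -[x y] [/= Ax By].
  by exists (A, B) => //; split; exact: open_nbhs_nbhs.
split=> [wm U1 V1 U2 V2 oU1 oV1 oU2 oV2 [u1 Uu1] [v1 Vv1] [u2 Uu2] [v2 Vv2]|wm].
  apply: (@sub_infinite_set _ (hitting_times (fun p : X * X => (T p.1, T p.2))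
      (U1 `*` U2) (V1 `*` V2))).
    move=> n [p []]; rewrite /= iterTT => -[/= V1p V2p] [/= U1p U2p].
    by split; [exists p.1|exists p.2].
  by apply: wm; [exact: openX|exact: openX|exists (u1, u2)|exists (v1, v2)].
have box (W : set (X * X)) : open W -> W !=set0 -> exists U V : set X,
    [/\ open U, open V, U !=set0, V !=set0 & U `*` V `<=` W].
  move=> oW [[x y] Wxy].
  have [[A B] /= [nA nB] ABW] : nbhs (x, y) W by exact: open_nbhs_nbhs.
  move: nA nB; rewrite !nbhsE => -[U [oU Ux] UA] [V [oV Vy] VB].
  exists U, V; split => //; [by exists x|by exists y|].
  by move=> [a b] [/= /UA Aa /VB Bb]; exact: ABW.
move=> W1 W2 oW1 oW2 /(box _ oW1)[U1 [U2 [oU1 oU2 U1n U2n UW]]].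
move=> /(box _ oW2)[V1 [V2 [oV1 oV2 V1n V2n VW]]].
apply: (@sub_infinite_set _ (N U1 V1 `&` N U2 V2)); last exact: wm.
move=> n [[x [Vx Ux]] [y [Vy Uy]]]; exists (x, y); split; last exact: UW.
by rewrite /= iterTT; exact: VW.
Qed.

(* A return time [n] of [U1 `&` T^-k V1] gives the hitting time [k + n] from [U1]
   to [V1]. *)
Lemma weakly_mixing_of_return : topologically_transitive T ->
  (forall U V W, open U -> open V -> open W ->
    U !=set0 -> V !=set0 -> W !=set0 -> infinite_set (N U U `&` N V W)) ->
  weakly_mixing T.
Proof.
move=> trT ret; apply/weakly_mixingP.
move=> U1 V1 U2 V2 oU1 oV1 oU2 oV2 U1n V1n U2n V2n.
have [k [x [Vx Ux]]] := infinite_setN0 (trT _ _ oU1 oV1 U1n V1n).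
have oU : open (U1 `&` iter k T @^-1` V1).
  by apply: openI => //; exact: open_iter_preimage.
have /infinite_nat_setP inf := ret _ _ _ oU oU2 (open_iter_preimage k oV2)
  (ex_intro _ x (conj Ux Vx)) U2n (iter_preimage_nonempty k V2n).
apply/infinite_nat_setP => m.
have [n [[y [[_ Vy] [Uy _]]] [z [Vz Uz]]] mn] := inf m.
exists (k + n)%N; last by rewrite (leq_trans mn)// leq_addl.
by split; [exists y|exists z]; rewrite /= iterD.
Qed.

(** Take as source the points of [U1] that reach [U2] after [k] steps. A common hitting time from it
    to [V1] and to the [k]-th preimage of [V2] serves both pairs; for the second, the point is moved
    forward by [k]. *)
Lemma weakly_mixing_of_common_source :
  (forall U V W, open U -> open V -> open W ->
    U !=set0 -> V !=set0 -> W !=set0 -> infinite_set (N U V `&` N U W)) ->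
  weakly_mixing T.
Proof.
move=> cs; apply/weakly_mixingP.
move=> U1 V1 U2 V2 oU1 oV1 oU2 oV2 U1n V1n U2n V2n.
have [k [[x [Vx Ux]] _]] := infinite_setN0 (cs _ _ _ oU1 oU2 oU2 U1n U2n U2n).
have oU : open (U1 `&` iter k T @^-1` U2).
  by apply: openI => //; exact: open_iter_preimage.
apply: sub_infinite_set (cs _ _ _ oU oV1 (open_iter_preimage k oV2)
  (ex_intro _ x (conj Ux Vx)) V1n (iter_preimage_nonempty k V2n)).
move=> n [[y [Vy [Uy _]]] [z [Vz [_ Uz]]]]; split; first by exists y.
by exists (iter k T z); split => //=; rewrite -iterD addnC iterD.
Qed.

Hypothesis wmT : weakly_mixing T.

(** Furstenberg's intersection argument: restrict [U'] and [V'] to the points entering [U i] and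
    [V i] after a common number [k] of steps. A hitting time of the restricted pair is one for [U'],
    [V'] and, through the [k]-th image of the point, for [U i], [V i]. *)
Lemma weakly_mixing_filter_base (I : choiceType) (s : seq I) (U V : I -> set X) :
  (forall i, open (U i)) -> (forall i, open (V i)) ->
  (forall i, U i !=set0) -> (forall i, V i !=set0) ->
  exists U0 V0, [/\ open U0, open V0, U0 !=set0, V0 !=set0 &
    forall i, i \in s -> N U0 V0 `<=` N (U i) (V i)].
Proof.
move=> oU oV U0 V0; elim: s => [|i s [U' [V' [oU' oV' U'n V'n sub]]]].
  exists setT, setT.
  by split => //; [exact: openT|exact: openT|exists point|exists point].
have /weakly_mixingP wm := wmT.
have [k [[x [Ux U'x]] [y [Vy V'y]]]] := infinite_setN0
  (wm _ _ _ _ oU' (oU i) oV' (oV i) U'n (U0 i) V'n (V0 i)).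
exists (U' `&` iter k T @^-1` U i), (V' `&` iter k T @^-1` V i); split.
- by apply: openI => //; exact: open_iter_preimage.
- by apply: openI => //; exact: open_iter_preimage.
- by exists x.
- by exists y.
move=> j; rewrite inE => /predU1P[->|/sub subj] n [z [[V'z Vz] [U'z Uz]]].
  by exists (iter k T z); split => //=; rewrite -iterD addnC iterD.
by apply: subj; exists z.
Qed.

(** By the filter base property some large [n] has all of [n, ..., n + p - 1] as hitting times of
    every pair, and one of these is a multiple of [p]. *)
Lemma weakly_mixing_multiples (I : finType) (U V : I -> set X) p m : (0 < p)%N ->
  (forall i, open (U i)) -> (forall i, open (V i)) ->
  (forall i, U i !=set0) -> (forall i, V i !=set0) ->
  exists2 q, (m <= q)%N & forall i, N (U i) (V i) (q * p)%N.
Proof.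
move=> p0 oU oV U0 V0.
have [U' [V' [oU' oV' U'n V'n sub]]] :=
  weakly_mixing_filter_base (enum I) oU oV U0 V0.
have [U1 [V1 [oU1 oV1 U1n V1n sub1]]] := @weakly_mixing_filter_base nat (iota 0 p)
  (fun=> U') (fun j => iter j T @^-1` V')
  (fun=> oU') (fun j => open_iter_preimage j oV')
  (fun=> U'n) (fun j => iter_preimage_nonempty j V'n).
have /weakly_mixingP wm := wmT.
have /infinite_nat_setP inf := wm _ _ _ _ oU1 oV1 oU1 oV1 U1n V1n U1n V1n.
have [n [N1n _] mn] := inf (m * p)%N.
(* The quotient of [n] by [p], rounded up. *)
pose q := ((n + p.-1) %/ p)%N.
have qn : (n <= q * p)%N by rewrite /q; lia.
have qp : (q * p < n + p)%N by rewrite /q; lia.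
exists q; first by rewrite /q leq_divRL// (leq_trans mn)// leq_addr.
move=> i; apply: (sub i); first by rewrite mem_enum.
have jp : (q * p - n)%N \in iota 0 p by rewrite mem_iota; lia.
have [x [Vx Ux]] := sub1 _ jp _ N1n.
exists x; split => //; move: Vx; rewrite /= -iterD subnK//.
Qed.

End hitting_times.

(** * Approximation by convex combinations *)

Section convex_sums.
Context (R : realType) (I : finType) (a : I -> R).
Hypotheses (a0 : forall i, 0 <= a i) (a1 : \sum_i a i = 1).

Lemma convex_sum_lt (c : I -> R) e : (forall i, c i < e) ->
  \sum_i a i * c i < e.
Proof.
(* Strictness comes from an index of positive weight; one exists because the weights sum to 1. *)
move=> ce; have [i ai] : exists i, 0 < a i.
  apply: contrapT => /forallNP na; have : \sum_i a i = 0.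
    by apply: big1 => i _; apply/eqP; rewrite eq_le a0 leNgt andbT; apply/negP/na.
  by rewrite a1 => /eqP; rewrite oner_eq0.
rewrite -[ltRHS]mul1r -a1 mulr_suml -subr_gt0 -sumrB (bigD1 i)//= ltr_wpDr//.
  by apply: sumr_ge0 => j _; rewrite -mulrBr mulr_ge0// subr_ge0 ltW.
by rewrite -mulrBr mulr_gt0// subr_gt0.
Qed.

Lemma sum_norm_convex_sum_le (J : Type) (s : seq J) (F : J -> I -> R) :
  \sum_(j <- s) `|\sum_i a i * F j i| <= \sum_i a i * \sum_(j <- s) `|F j i|.
Proof.
under [leRHS]eq_bigr do rewrite mulr_sumr.
rewrite exchange_big/=; apply: ler_sum => j _.
rewrite (le_trans (ler_norm_sum _ _ _))//; apply: ler_sum => i _.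
by rewrite normrM ger0_norm.
Qed.

Lemma sum_norm_convex_sum_lt (J : Type) (s : seq J) (F : J -> I -> R)
    (G : J -> R) e : (forall i, \sum_(j <- s) `|F j i - G j| < e) ->
  \sum_(j <- s) `|\sum_i a i * F j i - G j| < e.
Proof.
move=> FG; apply: (@le_lt_trans _ _
    (\sum_i a i * \sum_(j <- s) `|F j i - G j|)); last exact: convex_sum_lt.
apply: le_trans (sum_norm_convex_sum_le _ _); apply: ler_sum => j _.
under [in leRHS]eq_bigr do rewrite mulrBr.
by rewrite sumrB -mulr_suml a1 mul1r.
Qed.

Lemma state_convex_sum (X : topologicalType) (L : I -> (X -> R) -> R) :
  (forall i, state (L i)) -> state (fun f => \sum_i a i * L i f).
Proof.
move=> sL; split => [|f g cf cg|b f cf|f cf f0].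
- by rewrite -[RHS]a1; apply: eq_bigr => i _; have [-> _ _ _] := sL i; rewrite mulr1.
- rewrite -big_split/=; apply: eq_bigr => i _; have [_ -> // _ _] := sL i.
  by rewrite mulrDr.
- rewrite mulr_sumr; apply: eq_bigr => i _; have [_ _ -> // _] := sL i.
  by rewrite mulrCA.
- by apply: sumr_ge0 => i _; rewrite mulr_ge0//; have [_ _ _] := sL i; apply.
Qed.

End convex_sums.

Lemma state_eval (R : realType) (X : topologicalType) (x : X) :
  state (fun f : X -> R => f x).
Proof. by split. Qed.

Section discrete_approximation.
Context (R : realType) (X : ptopologicalType).
Hypothesis compactX : compact [set: X].
Implicit Types (fs : seq (continuousType X R)).

(** The pseudometric attached to [fs]; its value is also the total error on [fs] of replacing the
    point mass at [x] by that at [y]. *)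
Definition test_dist fs (x y : X) : R := \sum_(f <- fs) `|f y - f x|.

Lemma continuous_test_dist fs x : continuous (test_dist fs x).
Proof.
apply: continuous_sum_fun => f; apply: continuous_norm_fun.
by apply: continuousB_fun; [exact: cts_fun|exact: continuous_cst_fun].
Qed.

Lemma test_dist_refl fs x : test_dist fs x x = 0.
Proof. by apply: big1 => f _; rewrite subrr normr0. Qed.

Lemma test_dist_ge0 fs x y : 0 <= test_dist fs x y.
Proof. exact: sumr_ge0. Qed.

(** The bound [|L u| <= L |u|] is applied to each difference and summed. With [F f] constant this
    compares a state to a point mass; with [F f] a partition-of-unity average it gives the discrete
    approximation. *)
Lemma state_test_dist_le (L : (X -> R) -> R) fs (h : X -> R)
    (F : continuousType X R -> X -> R) : state L -> continuous h ->
  (forall f, continuous (F f)) ->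
  (forall y, \sum_(f <- fs) `|f y - F f y| <= h y) ->
  \sum_(f <- fs) `|L f - L (F f)| <= L h.
Proof.
move=> sL ch cF fh.
have cB (f : continuousType X R) : continuous (fun y => f y - F f y).
  by apply: continuousB_fun => //; exact: cts_fun.
apply: (@le_trans _ _ (L (fun y => \sum_(f <- fs) `|f y - F f y|))).
  rewrite (state_sum sL); last by move=> f; exact: continuous_norm_fun.
  apply: ler_sum => f _; rewrite -(stateB sL)//; last exact: cts_fun.
  rewrite ler_norml; apply/andP; split; last first.
    by apply: (state_le sL) => // [|y]; [exact: continuous_norm_fun|exact: ler_norm].
  have [_ _ LZ _] := sL; rewrite -mulN1r -LZ; last exact: continuous_norm_fun.
  apply: (state_le sL) => // [|y]; last by rewrite mulN1r lerNl -normrN ler_norm.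
  by apply: continuousZ_fun; exact: continuous_norm_fun.
apply: (state_le sL) => //; apply: continuous_sum_fun => f.
exact: continuous_norm_fun.
Qed.

(* The weights are the values of the state on a partition of unity subordinate
   to a finite cover by sets on which the test functions vary little. *)
Lemma discrete_approx (L : (X -> R) -> R) fs (e : R) : state L -> 0 < e ->
  exists (I : finType) (a : I -> R) (x : I -> X),
    [/\ forall i, 0 <= a i, \sum_i a i = 1
      & \sum_(f <- fs) `|L f - \sum_i a i * f (x i)| <= e].
Proof.
move=> sL e0.
have : finite_subset_cover [set: X]
    (fun x => [set y | test_dist fs x y < e]) [set: X].
  move: compactX; rewrite compact_cover; apply => [x _|y _].
    by apply: continuous_lt_open; exact: continuous_test_dist.
  by exists y => //=; rewrite test_dist_refl.
move=> [D _ DX].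
pose I : finType := finmap.fset_sub_type D.
pose x (i : I) : X := finmap.fsval i.
(* Tent functions, vanishing outside the [test_dist] ball of radius [e] about [x i]. *)
pose g (i : I) y := Num.max 0 (e - test_dist fs (x i) y).
have cg i : continuous (g i).
  apply: continuous_max_fun; first exact: continuous_cst_fun.
  by apply: continuousB_fun; [exact: continuous_cst_fun|exact: continuous_test_dist].
have g0 i y : 0 <= g i y by rewrite le_max lexx.
pose G y := \sum_i g i y.
have G0 y : 0 < G y.
  have [z zD yz] := DX y Logic.I.
  rewrite /G (bigD1 [` zD]%fset)//= ltr_wpDr//; first exact: sumr_ge0.
  by rewrite lt_max subr_gt0 yz orbT.
have cG : continuous G by exact: continuous_sum_fun.
pose phi i y := g i y / G y.
have cphi i : continuous (phi i).
  apply: continuousM_fun => // y; apply: cvgV; last exact: cG.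
  by rewrite gt_eqF.
have phi0 i y : 0 <= phi i y by rewrite divr_ge0// ltW.
have phi1 y : \sum_i phi i y = 1.
  by rewrite -mulr_suml -/(G y) divff// gt_eqF.
exists I, (fun i => L (phi i)), x; split.
- by move=> i; have [_ _ _] := sL; apply.
- rewrite -(state_sum sL)// -[RHS](state_cst sL); congr L.
  by apply/funext => y; rewrite phi1.
have LF f : L (fun y => \sum_i phi i y * f (x i)) = \sum_i L (phi i) * f (x i).
  have cphif i : continuous (fun y => phi i y * f (x i)).
    by apply: continuousM_fun => //; exact: continuous_cst_fun.
  rewrite (state_sum sL)//; apply: eq_bigr => i _.
  have [_ _ LZ _] := sL; rewrite mulrC -LZ//; congr L.
  by apply/funext => y; rewrite mulrC.
under eq_bigr do rewrite -LF.
rewrite -[leRHS](state_cst sL).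
apply: (@state_test_dist_le L fs (fun=> e)
  (fun f y => \sum_i phi i y * f (x i))) => //.
- exact: continuous_cst_fun.
- move=> f; apply: continuous_sum_fun => i.
  by apply: continuousM_fun => //; exact: continuous_cst_fun.
move=> y; apply: (@le_trans _ _ (\sum_i phi i y * test_dist fs (x i) y)).
  apply: le_trans (sum_norm_convex_sum_le (phi0^~ y) _ _).
  apply: ler_sum => f _; rewrite -[X in `|X - _|]mul1r -(phi1 y) mulr_suml -sumrB.
  by under eq_bigr do rewrite -mulrBr.
rewrite -[leRHS]mul1r -(phi1 y) mulr_suml; apply: ler_sum => i _.
(* A term either has distance below [e] or has zero weight. *)
have [ylt|ey] := ltP (test_dist fs (x i) y) e; first by rewrite ler_wpM2l// ltW.
suff -> : phi i y = 0 by rewrite !mul0r.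
by rewrite /phi /g max_l ?mul0r// subr_le0.
Qed.

(** Inside [W] each atom [x i] may be replaced by any state close to it on [fs]: by averages of
    point masses for transitivity, by periodic measures for density. *)
Lemma open_discrete (W : set (borel_prob R X)) : open W -> W !=set0 ->
  exists (I : finType) (a : I -> R) (x : I -> X) fs (e : R),
  [/\ forall i, 0 <= a i, \sum_i a i = 1, 0 < e
    & forall (L : I -> (X -> R) -> R) (nu : borel_prob R X),
        (forall i, \sum_(f <- fs) `|L i f - f (x i)| < e) ->
        (forall f, continuous f -> \int[nu]_x f x = \sum_i a i * L i f) -> W nu].
Proof.
move=> oW [mu Wmu].
have [fs [e [e0 BW]]] := nbhs_weak_star (open_nbhs_nbhs (conj oW Wmu)).
(* One half of the tolerance pays for the discrete approximation of [mu], the other for replacing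
   the atoms. *)
have e20 : 0 < e / 2 by rewrite divr_gt0.
have [I [a [x [a0 a1 ax]]]] := discrete_approx fs (integral_state compactX mu) e20.
exists I, a, x, fs, (e / 2); split => // L nu Lx nuL; apply: BW.
apply: (@le_lt_trans _ _ (\sum_(f <- fs) (`|\sum_i a i * (L i f - f (x i))| +
    `|\int[mu]_x f x - \sum_i a i * f (x i)|))).
  apply: ler_sum => f _; rewrite /integral_against nuL; last exact: cts_fun.
  under [X in _ <= `|X| + _]eq_bigr do rewrite mulrBr.
  rewrite sumrB [X in _ <= _ + X]distrC; apply: le_trans (ler_normD _ _).
  by rewrite addrA subrK.
rewrite big_split/= [ltRHS](splitr e) ltr_leD//.
apply: le_lt_trans (sum_norm_convex_sum_le _ _ _) _ => //.
exact: convex_sum_lt.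
Qed.

End discrete_approximation.

(** * Transfer between the space and its measures *)

Lemma hitting_timesM (X : topologicalType) (T : X -> X) k (U V : set X) n :
  hitting_times (iter k T) U V n <-> hitting_times T U V (n * k)%N.
Proof.
by split=> -[x [Vx Ux]]; exists x; split => //; move: Vx; rewrite /= iterM.
Qed.

Lemma totally_transitiveP (X : topologicalType) (T : X -> X) :
  totally_transitive T <-> forall k (U V : set X), (0 < k)%N ->
    open U -> open V -> U !=set0 -> V !=set0 ->
    infinite_set [set n | hitting_times T U V (n * k)%N].
Proof.
split=> tt k.
  move=> U V k0 oU oV U0 V0; apply: sub_infinite_set (tt _ k0 _ _ oU oV U0 V0).
  by move=> n /hitting_timesM.
move=> k0 U V oU oV U0 V0; apply: sub_infinite_set (tt _ _ _ k0 oU oV U0 V0).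
by move=> n /= ?; apply/hitting_timesM.
Qed.

Section transfer.
Context (R : realType) (X : pmetricType R) (T : continuousType X X).
Hypothesis compactX : compact [set: X].
Hypothesis surjT : set_surj [set: X] [set: X] T.
Local Notation M := (borel_prob R X).
Implicit Types (U V : set X) (f g : X -> R).

Definition mass_gt f (c : R) : set M := [set mu : M | c < \int[mu]_x f x].

Lemma open_mass_gt f c : continuous f -> open (mass_gt f c).
Proof. by move=> cf; apply: continuous_gt_open; exact: continuous_integral. Qed.

(** If no point of [U] reached [V] at time [n], the sum of [f] and of [g] after [n] steps would be
    at most 1 pointwise, while the two mass conditions make its integral exceed [c + d]. *)
Lemma hitting_times_mass_gt U V f g (c d : R) : continuous f -> continuous g ->
  (forall x, f x <= \1_U x) -> (forall x, g x <= \1_V x) -> 1 <= c + d ->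
  hitting_times (push T) (mass_gt f c) (mass_gt g d) `<=` hitting_times T U V.
Proof.
move=> cf cg fU gV cd n [mu [/= gmu fmu]]; apply: contrapT => noUV.
move: gmu fmu; rewrite /mass_gt/= integral_iter_push// => gmu fmu.
have sI := integral_state compactX mu.
have cgT : continuous (fun x => g (iter n T x)).
  by move=> x; apply: continuous_comp; [exact: continuous_iter|exact: cg].
have : \int[mu]_x (f x + g (iter n T x)) <= 1.
  rewrite -[leRHS](state_cst sI); apply: (state_le sI).
  - exact: continuousD_fun.
  - exact: continuous_cst_fun.
  - move=> x; rewrite (le_trans (lerD (fU x) (gV _)))// !indicE.
    have [xU|_] := boolP (x \in U); have [xV|_] := boolP (iter n T x \in V);
      rewrite ?addr0 ?add0r//.
    by exfalso; apply: noUV; exists x; split; apply/set_mem.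
have [_ -> // _ _] := sI.
by rewrite leNgt => /negP; apply; rewrite (le_lt_trans cd)// ltrD.
Qed.

Lemma infinite_hitting_times_transfer k U V : open U -> open V ->
  U !=set0 -> V !=set0 -> totally_transitive (push T : M -> M) -> (0 < k)%N ->
  infinite_set [set n | hitting_times T U V (n * k)%N].
Proof.
move=> oU oV U0 V0 /totally_transitiveP tt k0.
have [f [cf f0 fU [x fx]]] := open_bump oU U0.
have [g [cg g0 gV [y gy]]] := open_bump oV V0.
have nonempty (h : X -> R) z : continuous h -> h z = 1 -> mass_gt h (1 / 2) !=set0.
  move=> ch hz; have [mu muE] := riesz_representation compactX (state_eval R z).
  by exists mu; rewrite /mass_gt/= muE// hz; lra.
have := tt _ _ _ k0 (open_mass_gt (1 / 2) cf) (open_mass_gt (1 / 2) cg)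
  (nonempty _ _ cf fx) (nonempty _ _ cg gy).
apply: sub_infinite_set => n /=; apply: hitting_times_mass_gt => //; lra.
Qed.

Lemma weakly_mixing_of_push : topologically_transitive (push T : M -> M) ->
  weakly_mixing T.
Proof.
move=> tr; apply: weakly_mixing_of_common_source => // U V W oU oV oW U0 V0 W0.
have [f [cf f0 fU [x fx]]] := open_bump oU U0.
have [g [cg g0 gV [y gy]]] := open_bump oV V0.
have [h [ch h0 hW [z hz]]] := open_bump oW W0.
(* The equal-weight combination of the point masses at [y] and [z] integrates both [g] and [h] to at
   least 1/2. *)
have s2 : state (fun f : X -> R => 2^-1 * f y + 2^-1 * f z).
  split => [|a b _ _|a b _|a _ a0]; first by lra.
  - by rewrite !mulrDr addrACA.
  - by rewrite mulrDr !(mulrCA a).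
  - by rewrite addr_ge0// mulr_ge0// invr_ge0.
have [mu1 mu1E] := riesz_representation compactX (state_eval R x).
have [mu2 mu2E] := riesz_representation compactX s2.
(* The thresholds 3/4 and 1/4 sum to 1, as [hitting_times_mass_gt] asks, and 1/4 lies below the 1/2
   given by [mu2]. *)
have W1n : mass_gt f (3 / 4) !=set0.
  by exists mu1; rewrite /mass_gt/= mu1E// fx; lra.
have W2n : (mass_gt g (1 / 4) `&` mass_gt h (1 / 4)) !=set0.
  exists mu2; rewrite /mass_gt/=; split; rewrite /= mu2E//.
    by rewrite gy; have := g0 z; lra.
  by rewrite hz; have := h0 y; lra.
have oW1 : open (mass_gt f (3 / 4)) by exact: open_mass_gt.
have oW2 : open (mass_gt g (1 / 4) `&` mass_gt h (1 / 4)).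
  by apply: openI; exact: open_mass_gt.
apply: sub_infinite_set (tr _ _ oW1 oW2 W1n W2n) => n [mu [[gmu hmu] fmu]].
split.
  by apply: (@hitting_times_mass_gt _ _ f g (3 / 4) (1 / 4)) => //; [lra|exists mu].
by apply: (@hitting_times_mass_gt _ _ f h (3 / 4) (1 / 4)) => //; [lra|exists mu].
Qed.

Lemma totally_transitive_push : weakly_mixing T ->
  totally_transitive (push T : M -> M).
Proof.
move=> wm; apply/totally_transitiveP => p W1 W2 p0 oW1 oW2 W1n W2n.
have [I [a [x [fs [e [a0 a1 e0 HW1]]]]]] := open_discrete compactX oW1 W1n.
have [J [b [y [gs [d [b0 b1 d0 HW2]]]]]] := open_discrete compactX oW2 W2n.
(* One pair of open sets for each pair of atoms, so that a single time [q * p] serves all of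
   them. *)
pose U (ij : I * J) := [set z | test_dist fs (x ij.1) z < e].
pose V (ij : I * J) := [set z | test_dist gs (y ij.2) z < d].
apply/infinite_nat_setP => m.
have [q mq NUV] : exists2 q, (m <= q)%N &
    forall ij, hitting_times T (U ij) (V ij) (q * p)%N.
  apply: weakly_mixing_multiples => // ij.
  - by apply: continuous_lt_open; exact: continuous_test_dist.
  - by apply: continuous_lt_open; exact: continuous_test_dist.
  - by exists (x ij.1); rewrite /U/= test_dist_refl.
  - by exists (y ij.2); rewrite /V/= test_dist_refl.
exists q => //=.
have [z zUV] := choice NUV.
(* Product weights: the points [z (i, j)] sit near [x i] and their images near
   [y j], so the two marginals are the two discrete measures. *)
have sL := state_convex_sum a0 a1 (fun i => state_convex_sum b0 b1
  (fun j => state_eval R (z (i, j)))).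
have [nu nuE] := riesz_representation compactX sL.
exists nu; split => /=.
  apply: (HW2 (fun j f => \sum_i a i * f (iter (q * p) T (z (i, j))))).
    move=> j; apply: (sum_norm_convex_sum_lt a0 a1) => i.
    by have [] := zUV (i, j).
  move=> f cf; rewrite integral_iter_push// nuE; last first.
    by move=> w; apply: continuous_comp; [exact: continuous_iter|exact: cf].
  under eq_bigr do rewrite mulr_sumr.
  rewrite exchange_big/=; apply: eq_bigr => j _; rewrite mulr_sumr.
  by apply: eq_bigr => i _; rewrite mulrCA.
apply: (HW1 (fun i f => \sum_j b j * f (z (i, j)))); last by move=> f /nuE.
move=> i; apply: (sum_norm_convex_sum_lt b0 b1) => j.
by have [] := zUV (i, j).
Qed.

Lemma iter_fix (S : M -> M) k K (mu : M) : (k %| K)%N -> iter k S mu = mu ->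
  iter K S mu = mu.
Proof.
move=> /dvdnP[q ->] inv; rewrite iterM.
by elim: q => // q; rewrite iterS => ->.
Qed.

Lemma dense_periodic_push : almost_dense_periodic_sets R T ->
  dense (periodic_points (push T : M -> M)).
Proof.
move=> adp W [mu0 Wmu0] oW.
have [I [a [x [fs [e [a0 a1 e0 HW]]]]]] := open_discrete compactX oW
  (ex_intro _ mu0 Wmu0).
have [nu nuP] : {nu : I -> M & forall i,
    (exists2 k, (0 < k)%N & iter k (push T) (nu i) = nu i) /\
    \int[nu i]_z test_dist fs (x i) z < e}.
  apply: (@choice _ _ (fun i (nu : M) =>
    (exists2 k, (0 < k)%N & iter k (push T) nu = nu) /\
    \int[nu]_z test_dist fs (x i) z < e)) => i.
  have ch := @continuous_test_dist R X fs (x i).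
  have [C C0 hC] := compact_continuous_bounded compactX ch.
  have C1 : 0 < C + 1 by rewrite ltr_wpDl.
  pose U := [set z | test_dist fs (x i) z < e / 2].
  have oU : open U by exact: continuous_lt_open.
  (* This tolerance makes the integral of the test distance smaller than [e]: [U] contributes at
     most [e / 2], and its complement, where the distance is at most [C], less than [e / 2]. *)
  have [||k [nu [k0 inv nuU]]] := adp U (e / 2 / (C + 1)) oU.
  - by exists (x i); rewrite /U/= test_dist_refl divr_gt0.
  - by rewrite !divr_gt0.
  exists nu; split; first by exists k.
  have mU : measurable (~` U : set (borelType X)).
    by apply: measurableC; exact: open_borel.
  (* [h] is negative on [U] and below 1 elsewhere, so it lies below the indicator of the complement
     of [U]. *)
  pose h z := (C + 1)^-1 * (test_dist fs (x i) z - e / 2).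
  have cB : continuous (fun z => test_dist fs (x i) z - e / 2).
    by apply: continuousB_fun => //; exact: continuous_cst_fun.
  have : \int[nu]_z h z <= fine (nu (~` U)).
    apply: integral_le_measure => // [|z]; first exact: continuousZ_fun.
    rewrite /h mulrC ler_pdivrMr// indicE.
    have [_|] := boolP (z \in ~` U).
      by rewrite mul1r; have := hC z; rewrite ger0_norm ?test_dist_ge0// => ?; lra.
    by rewrite mul0r notin_setE /= => /contrapT; rewrite /U/= => ?; lra.
  have sI := integral_state compactX nu.
  have [_ _ IZ _] := sI; rewrite IZ// (stateB sI)//; last exact: continuous_cst_fun.
  rewrite (state_cst sI) => hle.
  have : fine (nu (~` U)) < e / 2 / (C + 1).
    by rewrite -lte_fin fineK// fin_num_measure.
  move/(le_lt_trans hle); rewrite mulrC ltr_pM2r ?invr_gt0// => ?; lra.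
have [k kP] := choice (fun i => let: conj (ex_intro2 k k0 inv) _ := nuP i in
  ex_intro (fun k => (0 < k)%N /\ iter k (push T) (nu i) = nu i) k (conj k0 inv)).
(* The product of the periods is a common period, so the combination of the [nu i] is periodic. *)
pose K := (\prod_i k i)%N.
have nuK i : iter K (push T) (nu i) = nu i.
  apply: (@iter_fix _ (k i)); last exact: (kP i).2.
  by rewrite /K (bigD1 i)//= dvdn_mulr.
have sL := state_convex_sum a0 a1 (fun i => integral_state compactX (nu i)).
have [mu muE] := riesz_representation compactX sL.
exists mu; split.
  apply: (HW (fun i f => \int[nu i]_x f x)) => // i.
  apply: le_lt_trans (nuP i).2.
  have sI := integral_state compactX (nu i).
  have := @state_test_dist_le _ _ _ fs _
    (fun (f : continuousType X R) _ => f (x i)) sI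
    (@continuous_test_dist R X fs (x i))
    (fun f : continuousType X R => @continuous_cst_fun R X (f (x i)))
    (fun=> lexx _).
  by under eq_bigr do rewrite (state_cst sI).
exists K; first by rewrite prodn_gt0// => i; exact: (kP i).1.
apply: (borel_prob_eq_integral compactX) => f cf.
have cfT : continuous (fun w => f (iter K T w)).
  by move=> w; apply: continuous_comp; [exact: continuous_iter|exact: cf].
rewrite integral_iter_push// !muE//; apply: eq_bigr => i _.
by rewrite -(integral_iter_push T K (nu i) cf) nuK.
Qed.

End transfer.

(** * The implications between the four statements *)

Lemma borel_diracE (R : realType) (Y : ptopologicalType) (y : Y)
    (A : set (borelType Y)) : measurable A ->
  to_borel_prob (dirac (y : borelType Y) : probability (borelType Y) R) A =
  (y \in A)%:R%:E.
Proof. by move=> mA; rewrite /= borel_restrE. Qed.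

Section almost_HY.
Context (R : realType) (X : pmetricType R) (T : continuousType X X).
Hypothesis compactX : compact [set: X].
Hypothesis surjT : set_surj [set: X] [set: X] T.
Local Notation M := (borel_prob R X).

Lemma totally_transitive1 (Y : topologicalType) (S : Y -> Y) :
  totally_transitive S -> topologically_transitive S.
Proof. by move=> /(_ 1%N (ltn0Sn _)). Qed.

Lemma almost_HY_weakly_mixing : almost_HY_system R T -> weakly_mixing T.
Proof.
move=> [tt adp]; apply: weakly_mixing_of_return => //.
  exact: totally_transitive1.
move=> U V W oU oV oW U0 V0 W0.
have half : (0 : R) < 1 / 2 by lra.
have [k [mu [k0 inv muU]]] := adp U _ oU U0 half.
have /infinite_nat_setP inf := (totally_transitiveP T).1 tt k V W k0 oV oW V0 W0.
apply/infinite_nat_setP => m; have [n NVW mn] := inf m.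
exists (n * k)%N; last by rewrite (leq_trans mn)// leq_pmulr.
split=> //; apply: contrapT => noUU.
have mU : measurable (~` U : set (borelType X)).
  by apply: measurableC; exact: open_borel.
have mSU : measurable (iter (n * k) T @^-1` (~` U) : set (borelType X)).
  by apply: borel_preimage => //; exact: continuous_iter.
(* Without a return at time [n * k], the complement of [U] and its preimage would cover the space,
   though by invariance each has mass below 1/2. *)
have UU : [set: X] = ~` U `|` iter (n * k) T @^-1` (~` U).
  apply/esym/seteqP; split => // x _; apply: contrapT => /not_orP[/contrapT Ux].
  by move=> /contrapT SUx; apply: noUU; exists x.
have : (mu (~` U `|` iter (n * k) T @^-1` (~` U)) <=
    mu (~` U) + mu (iter (n * k) T @^-1` (~` U)))%E.
  exact: measureU2.
rewrite -UU (probability_setT mu) -(iter_pushE T _ mu mU).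
rewrite (@iter_fix _ _ (push T) k) ?dvdn_mull//.
apply/negP; rewrite -ltNge (_ : 1%E = (1 / 2)%:E + (1 / 2)%:E)%E ?lteD//.
by rewrite -EFinD; congr (_%:E); lra.
Qed.

(** A function [f] below the indicator of [U] turns a large mass of [U] into a large integral, which
    passes to an ergodic measure and back to a large mass. *)
Lemma almost_HY_ergodic : almost_dense_periodic_sets R T ->
  forall (U : set X) (eps : R), open U -> U !=set0 -> 0 < eps ->
    exists (k : nat) (mu : M),
      [/\ (0 < k)%N, ergodic_measures (iter k T) mu & (mu (~` U) < eps%:E)%E].
Proof.
move=> adp U eps oU U0 eps0; have [k [mu [k0 inv]]] := adp U eps oU U0 eps0.
have mU := open_borel oU.
rewrite measure_setC_lt// => muU.
have [f [cf f0 fU muf]] : exists f : X -> R, [/\ continuous f, forall x, 0 <= f x,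
    forall x, f x <= \1_U x & 1 - eps < \int[mu]_x f x].
  apply: (open_inner_approx compactX) => //.
  by rewrite -(fineK (fin_num_measure mu _ mU)) lte_fin.
have [nu erg fnu] := exists_ergodic compactX inv cf.
exists k, nu; split => //; rewrite measure_setC_lt//.
apply: lt_le_trans muf _; apply: le_trans fnu _.
exact: integral_le_measure.
Qed.

Lemma ergodic_almost_dense_periodic_sets :
  (forall (U : set X) (eps : R), open U -> U !=set0 -> 0 < eps ->
    exists (k : nat) (mu : M),
      [/\ (0 < k)%N, ergodic_measures (iter k T) mu & (mu (~` U) < eps%:E)%E]) ->
  almost_dense_periodic_sets R T.
Proof.
move=> erg U eps oU U0 eps0; have [k [mu [k0 [inv _] muU]]] := erg U eps oU U0 eps0.
by exists k, mu; split => //; apply/invariantP.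
Qed.

(** The point mass at a periodic point of [U] is a periodic measure. [Y] is an arbitrary pointed
    space, since the application is to the space of measures. *)
Lemma P_system_almost_dense_periodic_sets (Y : ptopologicalType)
    (S : continuousType Y Y) :
  dense (periodic_points S) -> almost_dense_periodic_sets R S.
Proof.
move=> dS U eps oU U0 eps0; have [y [Uy [n n0 Sy]]] := dS U U0 oU.
exists n, (to_borel_prob (dirac (y : borelType Y))); split => //.
  apply: borel_prob_eq => A mA; rewrite iter_pushE//.
  have mSA : measurable (iter n S @^-1` A : set (borelType Y)).
    by apply: borel_preimage => //; exact: continuous_iter.
  rewrite !borel_diracE//; congr ((nat_of_bool _)%:R%:E).
  by apply/idP/idP => /set_mem yA; apply/mem_set; move: yA; rewrite /= Sy.
rewrite borel_diracE; last by apply: measurableC; exact: open_borel.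
by rewrite memNset ?lte_fin//= => /(_ Uy).
Qed.

(** Averaging the integrals of [f] over [P] is a state, so the representation theorem yields the
    measure. *)
Lemma barycenter (P : borel_prob R M) : exists mu : M, forall f, continuous f ->
  \int[mu]_x f x = \int[P]_nu (\int[(nu : M)]_x f x).
Proof.
apply: (riesz_representation compactX).
have cM := compact_borel_prob compactX.
have [IP1 IPD IPZ IP0] := integral_state cM P.
have cI f : continuous f -> continuous (fun nu : M => \int[nu]_x f x : R).
  exact: continuous_integral.
split => [|f g cf cg|a f cf|f cf f0].
- rewrite -[RHS]IP1; apply: eq_Rintegral => nu _.
  by have [-> _ _ _] := integral_state compactX nu.
- rewrite -IPD; [|exact: cI|exact: cI]; apply: eq_Rintegral => nu _.
  by have [_ -> // _ _] := integral_state compactX nu.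
- rewrite -IPZ; last exact: cI; apply: eq_Rintegral => nu _.
  by have [_ _ -> // _] := integral_state compactX nu.
- by apply: IP0 => [|nu]; [exact: cI|exact: Rintegral_ge0].
Qed.

(** The barycenter of a periodic [P] is periodic, and it gives [U] a large mass when [P] is
    concentrated on measures with a large integral of [f]. *)
Lemma almost_dense_periodic_sets_of_push :
  almost_dense_periodic_sets R (push T : continuousType M M) ->
  almost_dense_periodic_sets R T.
Proof.
move=> adp U eps oU U0 eps0.
have [f [cf f0 fU [x fx]]] := open_bump oU U0.
have cM := compact_borel_prob compactX.
(* Chosen so that [(1 - e)^2 >= 1 - 2 e >= 1 - eps] with [1 - e] positive; one factor is the
   integral threshold, the other bounds the mass under [P]. *)
pose e := Num.min eps 1 / 2.
have e0 : 0 < e by rewrite divr_gt0// lt_min eps0 ltr01.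
have eeps : 2 * e <= eps by rewrite /e mulrCA divff ?mulr1 ?ge_min ?lexx.
have e1 : 2 * e <= 1 by rewrite /e mulrCA divff ?mulr1 ?ge_min ?lexx ?orbT.
have oW : open (mass_gt f (1 - e)) by exact: open_mass_gt.
have W0 : mass_gt f (1 - e) !=set0.
  have [mu muE] := riesz_representation compactX (state_eval R x).
  by exists mu; rewrite /mass_gt/= muE// fx; lra.
have [k [P [k0 inv PW]]] := adp _ _ oW W0 e0.
have [mu muE] := barycenter P.
exists k, mu; split => //.
  apply: (borel_prob_eq_integral compactX) => h ch.
  have chT : continuous (fun w => h (iter k T w)).
    by move=> w; apply: continuous_comp; [exact: continuous_iter|exact: ch].
  rewrite integral_iter_push// !muE//.
  rewrite -[in RHS]inv (integral_iter_push (push T)).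
    by apply: eq_Rintegral => nu _; rewrite integral_iter_push.
  exact: continuous_integral.
rewrite measure_setC_lt//.
apply: (@lt_le_trans _ _ (\int[mu]_x f x)); last first.
  by apply: integral_le_measure => //; exact: open_borel.
rewrite muE//; have := PW; rewrite measure_setC_lt// => PW0.
have e1' : 0 < 1 - e by lra.
(* Markov's inequality for the integral of [f] as a function of the measure. *)
have : fine (P (mass_gt f (1 - e))) <=
    \int[P]_nu ((1 - e)^-1 * (\int[(nu : M)]_x f x)).
  apply: measure_le_integral => //; first exact: open_borel.
  - by apply: continuousZ_fun; exact: continuous_integral.
  - move=> nu; rewrite mulrC ler_pdivlMr// indicE.
    have [/set_mem|_] := boolP (nu \in mass_gt f (1 - e)).
      by rewrite mul1r => /ltW.
    by rewrite mul0r; exact: Rintegral_ge0.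
have [_ _ IZ _] := integral_state cM P.
rewrite IZ; last exact: continuous_integral.
move=> /(lt_le_trans PW0); rewrite mulrC ltr_pdivlMr// => ?; nra.
Qed.

End almost_HY.

Theorem theorem4p10 (R : realType) (X : pmetricType R) (T : continuousType X X)
    (compactX : compact [set: X]) (surjT : set_surj [set: X] [set: X] T) :
  [<-> almost_HY_system R T;
       weakly_mixing T /\
         (forall (U : set X) (eps : R), open U -> U !=set0 -> 0 < eps ->
            exists (k : nat) (mu : borel_prob R X),
              [/\ (0 < k)%N, ergodic_measures (iter k T) mu
                & (mu (~` U) < eps%:E)%E]);
       P_system (push T : borel_prob R X -> borel_prob R X);
       almost_HY_system R (push T : continuousType (borel_prob R X) (borel_prob R X))].
Proof.
tfae.
- move=> hy; split; first exact: almost_HY_weakly_mixing.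
  by apply: almost_HY_ergodic => //; exact: hy.2.
- move=> [wm erg]; split.
    by apply: totally_transitive1; exact: totally_transitive_push.
  by apply: dense_periodic_push => //; exact: ergodic_almost_dense_periodic_sets.
- move=> [tr dP]; split.
    by apply: totally_transitive_push => //; exact: weakly_mixing_of_push.
  exact: P_system_almost_dense_periodic_sets.
- move=> [tt adp]; split; last exact: almost_dense_periodic_sets_of_push.
  apply/totally_transitiveP => k U V k0 oU oV U0 V0.
  exact: infinite_hitting_times_transfer.
Qed.
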